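(* Let $(A_m)_{m\in\mathbb{N}}\in\mathrm{GL}_d(\mathbb{R})^{\mathbb{N}}$ be such that the following are true: (i) $\lim_{m\to\infty}\sigma_{\min}(A_m)=\infty$. (ii) The inclusion $\Psi_m\subseteq\Psi_{m+1}$ holds for all $m\in\mathbb{N}$, where $\Psi_m:=D^1_{A_m^{-1}}\Psi$. Then $\Psi_\infty:=\bigcup_{m\in\mathbb{N}}\Psi_m$ is a semi-discrete Parseval frame, i.e. $\sum_{\psi\in\Psi_\infty}\|f*\psi\|_2^2=\|f\|_2^2$ for all $f\in L^2(\mathbb{R}^d)$. Moreover, for all $f\in L^2(\mathbb{R}^d)$ and $k\in\mathbb{N}$, $$\lim_{m\to\infty}W_k[\Psi](D^2_{A_m}f)=\|f\|_2^2.$$ In particular, $\inf_{f\in L^2(\mathbb{R}^d),\,\|f\|_2=1}\ \inf_{k\in\mathbb{N}}\ \limsup_{m\to\infty}W_k[\Psi](D^2_{A_m}f)=1$, and consequently: for every $g\in L^2(\mathbb{R}^d)$ there exists a constant $C_g>0$ such that for any nonincreasing null-sequence $E=(E_N)_{N\in\mathbb{N}}\in\mathbb{R}_{>0}^{\mathbb{N}}$ there is $f_{g,E}\in L^2(\mathbb{R}^d)$ with a) $\|f_{g,E}\|_2^2\le C_g(1+E_1)$, b) $\|f_{g,E}-g\|_2^2\le C_g E_1$, and c) $W_N[\Psi](f_{g,E})\ge\frac{\|g\|_2^2}{8}\cdot E_N$ for all $N\in\mathbb{N}$; furthermore, for any such $E$, the set $Y_E:=\{f\in L^2(\mathbb{R}^d):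 W_N[\Psi](f)\in\mathcal{O}(E_N)\}$ is a countable union of nowhere dense sets in $L^2(\mathbb{R}^d)$, and in particular $L^2(\mathbb{R}^d)\setminus Y_E$ is dense in $L^2(\mathbb{R}^d)$.
   Context: Fix $d\in\mathbb{N}=\{1,2,\dots\}$. $L^2(\mathbb{R}^d)$ is the space of complex-valued square-integrable functions. Standing assumption on the filters: $\chi\in L^1(\mathbb{R}^d)\cap L^2(\mathbb{R}^d)$ and $\Psi\subset L^1(\mathbb{R}^d)\cap L^2(\mathbb{R}^d)$ are such that $\mathfrak{F}=\{\chi\}\cup\Psi$ is countably infinite and is a semi-discrete Parseval frame, i.e. $\|f*\chi\|_2^2+\sum_{\psi\in\Psi}\|f*\psi\|_2^2=\|f\|_2^2$ for all $f\in L^2(\mathbb{R}^d)$. For a path $p=(\psi_1,\dots,\psi_N)$ of functions in $L^1(\mathbb{R}^d)\cap L^2(\mathbb{R}^d)$ set $U[p]f:=|\dots||f*\psi_1|*\psi_2|\dots*\psi_N|$ (convolve, take the pointwise modulus, and iterate), and $U[e]f:=f$ for the empty path $e$. The energy remainder is $W_N[\Psi](f):=\sum_{p\in\Psi^N}\|U[p]f\|_2^2$. For $A\in\mathrm{GL}_d(\mathbb{R})$ and $p\in\{1,2\}$, $D_A^pf:=|\det A|^{1/p}f(A\,\cdot)$, and $D^1_A\Psi:=\{D^1_A\psi:\psi\in\Psi\}$. $\sigma_{\min}(A)$ is the smallest singular value of $A$. A null-sequence is a sequence converging to $0$. $W_N\in\mathcal{O}(E_N)$ means: there exist $C>0$,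 $N_0\in\mathbb{N}$ with $W_N\le C E_N$ for all $N\ge N_0$. *)

(* Defs.v *)
From HB Require Import structures.
From mathcomp Require Import all_boot all_order all_algebra.
From mathcomp Require Import complex.
From mathcomp Require Import all_classical all_reals all_analysis.
From mathcomp Require Import measurable_realfun.

Set Implicit Arguments.
Unset Strict Implicit.
Unset Printing Implicit Defensive.

Import Order.TTheory GRing.Theory Num.Theory.
Import numFieldNormedType.Exports.

Local Open Scope classical_set_scope.
Local Open Scope ring_scope.

Section cV_measurable.
Context {R : realType} (n : nat).

Let coords : 'I_n -> 'cV[R]_n -> R := fun i x => x i ord0.

Let cV_set0 : g_sigma_preimage coords set0.
Proof. exact: sigma_algebra0. Qed.

Let cV_setC A : g_sigma_preimage coords A -> g_sigma_preimage coords (~` A).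
Proof. exact: sigma_algebraC. Qed.

Let cV_bigcup (F : _^nat) : (forall i, g_sigma_preimage coords (F i)) ->
  g_sigma_preimage coords (\bigcup_i (F i)).
Proof. exact: sigma_algebra_bigcup. Qed.

HB.instance Definition _ := @isMeasurable.Build default_measure_display
  'cV[R]_n (g_sigma_preimage coords) cV_set0 cV_setC cV_bigcup.

End cV_measurable.

Section lebesgue_measure_cV.
Context {R : realType}.

Lemma measurable_coord n (i : 'I_n) :
  measurable_fun [set: 'cV[R]_n] (fun x : 'cV[R]_n => x i ord0).
Proof.
move=> _ Y mY; rewrite setTI; apply: sub_sigma_algebra => /=.
rewrite -bigcup_seq/=; exists i => /=; first by rewrite mem_index_enum.
by exists Y => //; rewrite setTI.
Qed.

Lemma measurable_fun_coord d (T : measurableType d) n (f : T -> 'cV[R]_n) :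
  (forall i, measurable_fun [set: T] (fun t => f t i ord0)) ->
  measurable_fun [set: T] f.
Proof.
move=> mf _ A mA; rewrite setTI.
suff: smallest (sigma_algebra [set: 'cV[R]_n]) (\big[setU/set0]_(i < n)
    preimage_set_system setT (fun x : 'cV[R]_n => x i ord0) measurable)
    `<=` [set B | measurable (f @^-1` B)] by exact.
apply: smallest_sub.
  split => [|B /= mB|F /= mF].
  - by rewrite /= preimage_set0.
  - by rewrite setTD preimage_setC; exact: measurableC.
  - by rewrite preimage_bigcup; exact: bigcup_measurable.
move=> B; rewrite -bigcup_seq/= => -[i _ [C mC <-]].
by rewrite setTI; have := mf i measurableT C mC; rewrite setTI.
Qed.

Definition consv n (p : measurableTypeR R * 'cV[R]_n) : 'cV[R]_n.+1 :=
  col_mx (p.1 : R)%:M p.2.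

Lemma consv0 n p : @consv n p ord0 ord0 = p.1.
Proof.
have -> : ord0 = lshift n (ord0 : 'I_1) by exact/val_inj.
by apply: etrans (col_mxEu _ _ _ _) _; rewrite mxE eqxx mulr1n.
Qed.

Lemma consv_lift n p i : @consv n p (lift ord0 i) ord0 = p.2 i ord0.
Proof.
have -> : lift ord0 i = rshift 1 i by exact/val_inj.
exact: col_mxEd.
Qed.

Lemma measurable_consv n : measurable_fun setT (@consv n).
Proof.
apply: measurable_fun_coord => i; have [j ->|->] := unliftP ord0 i.
  under eq_fun do rewrite consv_lift.
  exact: measurableT_comp (measurable_coord j) measurable_snd.
by under eq_fun do rewrite consv0; exact: measurable_fst.
Qed.

HB.instance Definition _ n :=
  @isMeasurableFun.Build _ _ _ _ (@consv n) (@measurable_consv n).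

Definition unconsv n (x : 'cV[R]_n.+1) : measurableTypeR R * 'cV[R]_n :=
  (x ord0 ord0, \col_i x (lift ord0 i) ord0).

Lemma consvK n : cancel (@consv n) (@unconsv n).
Proof.
move=> p; rewrite /unconsv consv0 [RHS]surjective_pairing; congr pair.
by apply/colP => i; rewrite mxE consv_lift.
Qed.

Lemma unconsvK n : cancel (@unconsv n) (@consv n).
Proof.
move=> x; apply/colP => i; rewrite [0](_ : _ = ord0)//.
have [j ->|->] := unliftP ord0 i; last by rewrite consv0.
by rewrite consv_lift mxE.
Qed.

Lemma measurable_unconsv n : measurable_fun setT (@unconsv n).
Proof.
apply/measurable_fun_pairP; split; first exact: measurable_coord.
apply: measurable_fun_coord => i /=; under eq_fun do rewrite mxE.
exact: measurable_coord.
Qed.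

Section step.
Variables (n : nat) (mu : {sigma_finite_measure set 'cV[R]_n -> \bar R}).

Definition lebesgue_cons : set 'cV[R]_n.+1 -> \bar R :=
  pushforward (lebesgue_measure \x mu)%E (@consv n).

Let lebesgue_cons0 : lebesgue_cons set0 = 0%E.
Proof. by rewrite /lebesgue_cons /pushforward preimage_set0 measure0. Qed.

Let lebesgue_cons_ge0 A : (0 <= lebesgue_cons A)%E.
Proof. exact: measure_ge0. Qed.

Let lebesgue_cons_sigma_additive : semi_sigma_additive lebesgue_cons.
Proof.
exact: measure_semi_sigma_additive.
Qed.

HB.instance Definition _ := isMeasure.Build _ _ _ lebesgue_cons
  lebesgue_cons0 lebesgue_cons_ge0 lebesgue_cons_sigma_additive.

Lemma lebesgue_cons_sigma_finite : sigma_finite setT lebesgue_cons.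
Proof.
have /sigma_finiteP[F [TF ndF Foo]] := sigma_finiteT (@lebesgue_measure R).
have /sigma_finiteP[G [TG ndG Goo]] := sigma_finiteT mu.
exists (fun k => @unconsv n @^-1` (F k `*` G k)).
  rewrite -preimage_bigcup; apply/esym/seteqP; split=> // x _ /=.
  have [a _ Fa] : (\bigcup_i F i) (unconsv x).1 by rewrite -TF.
  have [b _ Gb] : (\bigcup_i G i) (unconsv x).2 by rewrite -TG.
  exists (maxn a b) => //; split.
    by move: Fa; exact/subsetPset/ndF/leq_maxl.
  by move: Gb; exact/subsetPset/ndG/leq_maxr.
move=> k; have [mF Fk] := Foo k; have [mG Gk] := Goo k; split.
  rewrite -[X in measurable X]setTI; apply: measurable_unconsv => //.
  exact: measurableX.
rewrite /lebesgue_cons /pushforward -comp_preimage.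
rewrite (_ : _ \o _ = id) ?preimage_id; last first.
  by apply/funext => p; rewrite /= consvK.
by rewrite product_measure1E// lte_mul_pinfty// ge0_fin_numE.
Qed.

HB.instance Definition _ :=
  Measure_isSigmaFinite.Build _ _ _ lebesgue_cons lebesgue_cons_sigma_finite.

End step.

(* Lebesgue measure on R^n (restricted to Borel sets), by R^(n+1) = R x R^n;
   see lebesgue_cV_box below. *)
Fixpoint lebesgue_cV (n : nat) : {sigma_finite_measure set 'cV[R]_n -> \bar R} :=
  if n is m.+1 then lebesgue_cons (lebesgue_cV m) else dirac (0 : 'cV[R]_0).

Lemma lebesgue_cV_box n (A : 'I_n -> set R) :
  (forall i, measurable (A i)) ->
  lebesgue_cV n [set x | forall i, A i (x i ord0)] =
  (\prod_(i < n) lebesgue_measure (A i : set (measurableTypeR R)))%E.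
Proof.
elim: n A => [|n IHn] A mA.
  by rewrite big_ord0 /= /dirac /= indicE mem_set// => -[].
rewrite big_ord_recl /= -IHn//.
rewrite /lebesgue_cons /pushforward (_ : _ @^-1` _ =
  (A ord0 : set (measurableTypeR R)) `*`
  [set x : 'cV_n | forall i, A (lift ord0 i) (x i ord0)]); last first.
  apply/seteqP; split=> [p /= Ap|p /= [Ap1 Ap2] i].
    split=> [|i]; first by have := Ap ord0; rewrite consv0.
    by have := Ap (lift ord0 i); rewrite consv_lift.
  have [j ->|->] := unliftP ord0 i; first by rewrite consv_lift.
  by rewrite consv0.
rewrite product_measure1E//; first exact: mA.
rewrite (_ : [set _ | _] = \bigcap_(i in [set: 'I_n])
    ((fun x : 'cV[R]_n => x i ord0) @^-1` A (lift ord0 i))); last first.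
  by apply/seteqP; split => x /= Ax i => [_|]; apply: Ax.
apply: fin_bigcap_measurable => // i _; rewrite -[X in measurable X]setTI.
by apply: measurable_coord => //; exact: mA.
Qed.

End lebesgue_measure_cV.

Section complex_functions.
Context {R : realType} {d : nat}.
Implicit Types f g : 'cV[R]_d -> R[i].

Definition cmeasurable f :=
  measurable_fun setT (fun x => complex.Re (f x)) /\
  measurable_fun setT (fun x => complex.Im (f x)).

Definition Lpnorm (p : nat) f : \bar R :=
  Lnorm (lebesgue_cV d) (p%:R)%:E (fun x => (Normc.normc (f x))%:E).

Lemma measurable_normc f : cmeasurable f ->
  measurable_fun setT (fun x => Normc.normc (f x)).
Proof.
move=> [mRe mIm]; rewrite (_ : (fun _ => _) = fun x =>
  Num.sqrt (complex.Re (f x) ^+ 2 + complex.Im (f x) ^+ 2)).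
  have msqrt : measurable_fun [set: R] (Num.sqrt : R -> R).
    apply: continuous_measurable_fun; exact: sqrt_continuous.
  apply: (measurableT_comp msqrt).
  by apply: measurable_funD; exact: measurable_funX.
by apply/funext => x; case: (f x).
Qed.

Lemma cmeasurable0 : cmeasurable (0 : 'cV[R]_d -> R[i]).
Proof. by split; exact: measurable_cst. Qed.

Lemma cmeasurableD f g : cmeasurable f -> cmeasurable g -> cmeasurable (f + g).
Proof.
move=> [mf mf'] [mg mg']; split.
  rewrite (_ : (fun _ => _) = fun x => complex.Re (f x) + complex.Re (g x)).
    exact: measurable_funD.
  by apply/funext => x; rewrite fctE; case: (f x); case: (g x).
rewrite (_ : (fun _ => _) = fun x => complex.Im (f x) + complex.Im (g x)).
  exact: measurable_funD.
by apply/funext => x; rewrite fctE; case: (f x); case: (g x).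
Qed.

Lemma cmeasurableN f : cmeasurable f -> cmeasurable (- f).
Proof.
move=> [mf mf']; split.
  rewrite (_ : (fun _ => _) = fun x => - complex.Re (f x)).
    exact: measurable_funN.
  by apply/funext => x; rewrite fctE; case: (f x).
rewrite (_ : (fun _ => _) = fun x => - complex.Im (f x)).
  exact: measurable_funN.
by apply/funext => x; rewrite fctE; case: (f x).
Qed.

Lemma Lpnorm_ge0 p f : (0 <= Lpnorm p f)%E.
Proof. exact: Lnorm_ge0. Qed.

Lemma Lpnorm0 p : (0 < p)%N -> Lpnorm p 0 = 0%E.
Proof.
move=> p0; rewrite /Lpnorm (_ : (fun _ => _) = cst 0%E).
  by rewrite Lnorm0// eqe pnatr_eq0 -lt0n.
by apply/funext => x; rewrite Normc.normc0.
Qed.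

Lemma LpnormN p f : Lpnorm p (- f) = Lpnorm p f.
Proof. by apply: eq_Lnorm => x; rewrite fctE normcN. Qed.

Lemma Lpnorm_ae p f g : cmeasurable f -> cmeasurable g ->
  f = g %[ae lebesgue_cV d] -> Lpnorm p f = Lpnorm p g.
Proof.
move=> mf mg fg; rewrite /Lpnorm unlock; congr (_ `^ _)%E.
apply: ge0_ae_eq_integral => //.
- apply: (measurableT_comp (measurable_poweR _)) => //.
  apply: measurableT_comp => //; apply/measurable_EFinP.
  exact: measurable_normc.
- apply: (measurableT_comp (measurable_poweR _)) => //.
  apply: measurableT_comp => //; apply/measurable_EFinP.
  exact: measurable_normc.
- by move=> x _; exact: poweR_ge0.
- by move=> x _; exact: poweR_ge0.
- by apply: filterS fg => x fg xT; rewrite fg.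
Qed.

Lemma Lpnorm_eq0 p f : (0 < p)%N -> cmeasurable f ->
  Lpnorm p f = 0%E -> f = 0 %[ae lebesgue_cV d].
Proof.
move=> p0 mf /Lnorm_eq0_eq0 h.
have : (fun x => (Normc.normc (f x))%:E) = \0%E %[ae lebesgue_cV d].
  apply: h; last by rewrite lte_fin ltr0n.
  by apply/measurable_EFinP; exact: measurable_normc.
by apply: filterS => x fx xT; apply: Normc.eq0_normc; case: (fx xT).
Qed.

Lemma Lpnorm_triangle p f g : (0 < p)%N -> cmeasurable f -> cmeasurable g ->
  (Lpnorm p (f + g)%R <= Lpnorm p f + Lpnorm p g)%E.
Proof.
move=> p0 mf mg.
have mfg := measurable_normc (cmeasurableD mf mg).
have {}mf := measurable_normc mf.
have {}mg := measurable_normc mg.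
have p1 : (1 <= p%:R%:E :> \bar R)%E by rewrite lee_fin ler1n.
apply: le_trans (eminkowski (lebesgue_cV d) mf mg p1).
rewrite /Lpnorm unlock gt0_ler_poweR ?invr_ge0//.
- by rewrite in_itv/= leey integral_ge0// => x _; exact: poweR_ge0.
- by rewrite in_itv/= leey integral_ge0// => x _; exact: poweR_ge0.
apply: ge0_le_integral => //.
- by move=> x _; exact: poweR_ge0.
- apply: (measurableT_comp (measurable_poweR _)) => //.
  by apply: measurableT_comp => //; exact/measurable_EFinP.
- apply: (measurableT_comp (measurable_poweR _)) => //.
  apply: measurableT_comp => //; apply/measurable_EFinP.
  exact: measurable_funD.
have n0 (z : R[i]) : 0 <= Normc.normc z by case: z => a b; exact: sqrtr_ge0.
move=> x _; apply: gt0_ler_poweR; first exact: ler0n.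
- by rewrite in_itv/= leey lee_fin normr_ge0.
- by rewrite in_itv/= leey lee_fin normr_ge0.
rewrite lee_fin !ger0_norm ?addr_ge0//.
exact: (le_normcD (f x : Rcomplex R) (g x)).
Qed.

Lemma Lpnorm_natmul p f n : (0 < p)%N -> cmeasurable f ->
  (Lpnorm p f < +oo)%E -> Lpnorm p (f *+ n)%R = (n%:R%:E * Lpnorm p f)%E.
Proof.
move=> p0 mf foo.
have p1 : (1 <= p%:R%:E :> \bar R)%E by rewrite lee_fin ler1n.
have fL : (fun x => Normc.normc (f x)) \in Lfun (lebesgue_cV d) p%:R%:E.
  by rewrite inE; apply/andP; split; rewrite inE//=; exact: measurable_normc.
have := LnormZ (Lfun_Sub p1 fL) n%:R; rewrite Lfun_valP normr_nat => <-.
apply: eq_Lnorm => x /=; congr _%:E.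
rewrite -[RHS]/(n%:R * _) mulr_natl -normcMn; congr Normc.normc.
by rewrite natmulfctE.
Qed.

(* Re and Im of the integrand are integrable for all x when f and g are square
   integrable; Rintegral is not meaningful otherwise. The value depends only on
   the a.e. classes of f and g. *)
Definition convolution f g : 'cV[R]_d -> R[i] := fun x =>
  ((\int[lebesgue_cV d]_y complex.Re (f y * g (x - y))) +i*
   (\int[lebesgue_cV d]_y complex.Im (f y * g (x - y))))%C.

Definition modulus f : 'cV[R]_d -> R[i] := fun x => ((Normc.normc (f x))%:C)%C.

Definition dilate (p : nat) (A : 'M[R]_d) f : 'cV[R]_d -> R[i] := fun x =>
  ((`|\det A| `^ (p%:R)^-1)%:C)%C * f (A *m x).

End complex_functions.

Section L2_space.
Context (R : realType) (d : nat).

Definition sq_integrable : {pred 'cV[R]_d -> R[i]} :=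
  fun f => `[< cmeasurable f /\ (Lpnorm 2 f < +oo)%E >].

Lemma sq_integrable_zmod_closed : zmod_closed sq_integrable.
Proof.
split=> [|f g /asboolP[mf foo] /asboolP[mg goo]].
  by apply/asboolP; split; [exact: cmeasurable0|rewrite Lpnorm0].
have mNg := cmeasurableN mg.
apply/asboolP; split; first exact: cmeasurableD.
apply: le_lt_trans (Lpnorm_triangle _ mf mNg) _ => //.
by rewrite LpnormN lte_add_pinfty.
Qed.

HB.instance Definition _ :=
  GRing.isZmodClosed.Build _ sq_integrable sq_integrable_zmod_closed.

Record L2fun := MkL2fun {
  L2fun_val :> 'cV[R]_d -> R[i];
  _ : L2fun_val \in sq_integrable }.

HB.instance Definition _ := [isSub for L2fun_val].
HB.instance Definition _ := [Choice of L2fun by <:].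
HB.instance Definition _ := [SubChoice_isSubZmodule of L2fun by <:].

Definition ae_zero : {pred L2fun} := fun f => `[< f = 0 %[ae lebesgue_cV d] >].

Lemma ae_zero_zmod_closed : zmod_closed ae_zero.
Proof.
split=> [|f g /asboolP f0 /asboolP g0]; apply/asboolP.
  by apply: nearW.
apply: filterS2 f0 g0 => x f0 g0 xT.
rewrite (_ : L2fun_val (f - g) x = f x - g x)//.
by rewrite f0// g0// subr0.
Qed.

HB.instance Definition _ :=
  GRing.isZmodClosed.Build _ ae_zero ae_zero_zmod_closed.

(* L^2(R^d; C) as a quotient by a.e. equality. It is only given the structure of
   a normed additive group, with norms in R: this determines its topology. *)
Definition L2 : Type := Quotient.quot ae_zero.

HB.instance Definition _ := GRing.Zmodule.on L2.
HB.instance Definition _ := isPointed.Build L2 0.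

Definition fun_of_L2 (f : L2) : 'cV[R]_d -> R[i] := L2fun_val (repr f).
Coercion fun_of_L2 : L2 >-> Funclass.

Definition L2_of_fun (f : L2fun) : L2 := (\pi f)%qT.

Lemma L2fun_cmeasurable (f : L2fun) : cmeasurable f.
Proof. by case: f => f /= /asboolP[]. Qed.

Lemma L2fun_Lpnorm (f : L2fun) : (Lpnorm 2 f < +oo)%E.
Proof. by case: f => f /= /asboolP[]. Qed.

Lemma L2_of_funP (f g : L2fun) :
  L2_of_fun f = L2_of_fun g <-> f = g %[ae lebesgue_cV d].
Proof.
split=> [/eqP|fg]; last apply/eqP.
  rewrite -Quotient.idealrBE => /asboolP; apply: filterS => x fg0 xT.
  by apply/eqP; rewrite -subr_eq0; apply/eqP; exact: fg0.
rewrite -Quotient.idealrBE; apply/asboolP; apply: filterS fg => x fg xT.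
by rewrite (_ : L2fun_val (f - g) x = f x - g x)// fg// subrr.
Qed.

Lemma L2_of_funK (f : L2fun) : L2_of_fun f = f %[ae lebesgue_cV d].
Proof. by apply/(L2_of_funP (repr (L2_of_fun f))); exact: reprK. Qed.

Lemma L2_of_fun0 : L2_of_fun 0 = 0.
Proof. exact: (@pi_zeror _ _ _ _ _ (Quotient.quot ae_zero)). Qed.

Lemma L2D (f g : L2) : (f + g : L2) = (fun x => f x + g x) %[ae lebesgue_cV d].
Proof.
apply: (L2_of_funP (repr (f + g)) (repr f + repr g)).1.
by rewrite /L2_of_fun reprK Quotient.pi_add /= !reprK.
Qed.

Lemma L2N (f : L2) : (- f : L2) = (fun x => - f x) %[ae lebesgue_cV d].
Proof.
apply: (L2_of_funP (repr (- f)) (- repr f)).1.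
by rewrite /L2_of_fun reprK Quotient.pi_opp /= reprK.
Qed.

Lemma L2Mn (f : L2) n :
  (f *+ n : L2) = (fun x => f x *+ n) %[ae lebesgue_cV d].
Proof.
elim: n => [|n IHn].
  apply: (L2_of_funP (repr 0) 0).1.
  by rewrite {1}/L2_of_fun reprK L2_of_fun0.
rewrite mulrS; apply: filterS2 (L2D f (f *+ n)) IHn => x -> // ih xT.
by rewrite ih// mulrS.
Qed.

Lemma L2_cmeasurable (f : L2) : cmeasurable f.
Proof. exact: L2fun_cmeasurable. Qed.

Lemma L2_Lpnorm (f : L2) : (Lpnorm 2 f < +oo)%E.
Proof. exact: L2fun_Lpnorm. Qed.

Definition L2norm (f : L2) : R := fine (Lpnorm 2 f).

Lemma EFin_L2norm (f : L2) : (L2norm f)%:E = Lpnorm 2 f.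
Proof. by rewrite fineK// ge0_fin_numE ?L2_Lpnorm// Lpnorm_ge0. Qed.

Lemma L2norm_triangle (f g : L2) : L2norm (f + g) <= L2norm f + L2norm g.
Proof.
have mf := L2_cmeasurable f; have mg := L2_cmeasurable g.
rewrite -lee_fin EFinD !EFin_L2norm.
rewrite (Lpnorm_ae _ _ (cmeasurableD mf mg) (L2D f g)).
  exact: Lpnorm_triangle.
exact: L2_cmeasurable.
Qed.

Lemma L2norm_eq0 (f : L2) : L2norm f = 0 -> f = 0.
Proof.
move=> f0; have mf := L2_cmeasurable f.
have {f0} : Lpnorm 2 f = 0%E by rewrite -EFin_L2norm f0.
move=> /(@Lpnorm_eq0 _ _ 2 _ isT mf) f0.
have : L2_of_fun (repr f) = L2_of_fun 0 by exact/L2_of_funP.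
by rewrite {1}/L2_of_fun reprK L2_of_fun0.
Qed.

Lemma L2normMn (f : L2) n : L2norm (f *+ n) = L2norm f *+ n.
Proof.
have mf := L2_cmeasurable f; apply/EFin_inj; rewrite EFin_L2norm.
have mfn : cmeasurable ((f : 'cV[R]_d -> R[i]) *+ n).
  elim: n => [|n IHn]; first by rewrite mulr0n; exact: cmeasurable0.
  by rewrite mulrS; exact: cmeasurableD.
rewrite (Lpnorm_ae _ (L2_cmeasurable _) mfn); last first.
  by rewrite natmulfctE; exact: L2Mn.
by rewrite Lpnorm_natmul ?L2_Lpnorm// -EFin_L2norm -EFinM mulr_natl.
Qed.

Lemma L2normN (f : L2) : L2norm (- f) = L2norm f.
Proof.
have mf := L2_cmeasurable f; apply/EFin_inj; rewrite !EFin_L2norm.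
rewrite (Lpnorm_ae _ (L2_cmeasurable _) (cmeasurableN mf) (L2N f)).
exact: LpnormN.
Qed.

HB.instance Definition _ := Num.Zmodule_isNormed.Build R L2
  L2norm_triangle L2norm_eq0 L2normMn L2normN.
HB.instance Definition _ := PseudoMetric.copy L2 (pseudoMetric_normed L2).
HB.instance Definition _ := NormedZmod_PseudoMetric_eq.Build R L2 erefl.

End L2_space.

Section scattering.
Context {R : realType} {d : nat}.
Implicit Types (Psi : set (L2 R d)) (f : 'cV[R]_d -> R[i]) (A : 'M[R]_d).

Definition singular_value A (s : R) :=
  exists2 a, eigenvalue (A^T *m A) a & s = Num.sqrt a.

(* For 0 < d the set of singular values is finite and nonempty, so that this
   infimum is a minimum. *)
Definition sigma_min A : R := inf [set s | singular_value A s].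

Definition semidiscrete_parseval_frame Psi := forall f : L2 R d,
  \esum_(psi in Psi) (Lpnorm 2 (convolution f (psi : L2 R d)) ^+ 2)%E = (`|f| ^+ 2)%:E.

(* The filters are classes of functions modulo a.e. equality: phi belongs to
   D^p_A Psi when D^p_A psi is a representative of phi for some psi in Psi. *)
Definition dilate_set (p : nat) A Psi : set (L2 R d) :=
  [set phi | exists2 psi : L2 R d,
    Psi psi & phi = dilate p A psi %[ae lebesgue_cV d]].

Definition propagate (p : seq (L2 R d)) f : 'cV[R]_d -> R[i] :=
  foldl (fun h (psi : L2 R d) => modulus (convolution h psi)) f p.

Definition energy_remainder (N : nat) Psi f : \bar R :=
  \esum_(p in [set p : N.-tuple (L2 R d) | forall i, Psi (tnth p i)])
    (Lpnorm 2 (propagate p f) ^+ 2)%E.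

(* E is a sequence indexed from 1: its value at 0 is irrelevant. *)
Definition positive_nonincreasing_null (E : nat -> R) :=
  [/\ forall N, (0 < N)%N -> 0 < E N,
      forall M N, (0 < M <= N)%N -> E N <= E M
    & E n @[n --> \oo] --> (0 : R)].

Definition remainder_bigO Psi (E : nat -> R) : set (L2 R d) :=
  [set f : L2 R d | exists2 C : R, 0 < C & exists2 N0, (0 < N0)%N &
    forall N, (N0 <= N)%N -> (energy_remainder N Psi f <= (C * E N)%:E)%E].

Definition nowhere_dense (T : topologicalType) (S : set T) :=
  (closure S)° = set0.

End scattering.

(* Main.v *)
Require Import Defs.
From mathcomp Require Import all_boot all_order all_algebra.
From mathcomp Require Import complex.
From mathcomp Require Import all_classical all_reals all_analysis.
From mathcomp Require Import measurable_realfun ring lra.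

Import Order.TTheory GRing.Theory Num.Theory.
Import numFieldNormedType.Exports.

(** Write W_N for the energy remainder of Psi, D_m for the L^2-normalised
    dilation by A_m, psi_m for the L^1-normalised dilation of psi by the inverse
    of A_m, Psi_m for the set of the psi_m with psi in Psi, and Psi_oo for the
    union of the Psi_m.

    The substitution z = A_m y turns (D_m f) * psi into D_m (f * psi_m)
    ([convolution_dilate]), and dilations commute with the modulus.  Hence
    W_k[Psi](D_m f) = W_k[Psi_m](f) ([energy_remainder_dilate]), and the same
    computation in one layer shows that the filters of Psi_m miss exactly the
    energy of (D_m f) * chi.  This energy vanishes in the limit: the norm of
    D_m f in L^1 is |det A_m|^(-1/2) times that of f, so that Young's inequality
    settles the case of f in L^1 and in L^2, and the general case follows because
    f -> (D_m f) * chi is bounded in L^2 uniformly in m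
    ([lowpass_dilate_cvg0]); that |det A_m| tends to infinity follows from
    sigma_min(A)^d <= |det A| ([sigma_min_det]).  As Psi_m increases to Psi_oo,
    sums over Psi_m and over its k-paths increase to those over Psi_oo.  So
    Psi_oo is a Parseval frame ([limit_frame]), no energy is lost in any of its
    layers, and W_k[Psi](D_m f) tends to the squared norm of f
    ([cvg_energy_remainder_dilate]).

    For the slow decay one needs to add a highly dilated function to an arbitrary
    one without interference.  Let L_N(f) be the energy that the low-pass filter
    has taken out of f in the first N layers, so that W_N(f) + L_N(f) is the
    squared norm of f.  The operators involved are nonexpansive, so the square
    roots of W_N and of L_N are 1-Lipschitz.  Since L_N(D_m h) tends to 0, the
    limit superior of L_N(u + D_m h) is at most the squared norm of u; and one
    may choose the sign of h so that the squared norm of u + D_m h is at least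
    the sum of the two squared norms.  Therefore W_N(u + D_m h) is at least the
    squared norm of h, up to an arbitrarily small error, however large N and
    whatever u ([hump]).

    A gliding hump finishes the proof: to g one adds humps v_j whose norms
    decrease like 3^-j, the j-th one being chosen after all the previous ones so
    that it survives until E_N has dropped below 9^-(j+1) E_1.  The later humps
    are too small to spoil this, and the series converges in L^2
    ([geometric_series_L2], [slow_decay]).  Likewise a single hump shows that no
    ball is contained in the closure of the set where W_N <= C E_N for all large
    N ([uniform_decay_nowhere_dense]).  The functions whose remainder is not
    O(E_N) are dense because decay no faster than c sqrt(E_N), which is not
    O(E_N), occurs arbitrarily close to every function ([dense_not_bigO]). *)

Local Open Scope classical_set_scope.
Local Open Scope ring_scope.

Set Implicit Arguments.
Unset Strict Implicit.
Unset Printing Implicit Defensive.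

(** * Linear change of variables for Lebesgue measure *)

Section linear_change_of_variables.
Context {R : realType}.

(** Stated with integrals of nonnegative functions rather than with measures of
    sets, so that it composes and can be proved one coordinate at a time by
    Tonelli's theorem. *)
Definition has_jacobian (d : nat) (c : R) (T : 'cV[R]_d -> 'cV[R]_d) :=
  measurable_fun setT T /\
  forall f : 'cV[R]_d -> \bar R, measurable_fun setT f ->
    (forall x, (0 <= f x)%E) ->
    (\int[lebesgue_cV d]_x f x = c%:E * \int[lebesgue_cV d]_x f (T x))%E.

Lemma has_jacobian_comp d (c c' : R) (S T : 'cV[R]_d -> 'cV[R]_d) :
  has_jacobian c S -> has_jacobian c' T -> has_jacobian (c * c') (S \o T).
Proof.
move=> [mS HS] [mT HT]; split; first exact: measurableT_comp.
move=> f mf f0; rewrite HS// (HT (f \o S))//; first by rewrite EFinM muleA.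
- exact: (measurableT_comp mf mS).
- by move=> x; exact: f0.
Qed.

(** Both sides are integrals against measures that agree on half-open intervals. *)
Lemma lebesgue_affine (a b : R) (f : measurableTypeR R -> \bar R) : a != 0 ->
  measurable_fun setT f -> (forall x, (0 <= f x)%E) ->
  (\int[lebesgue_measure]_x f x =
   `|a|%:E * \int[lebesgue_measure]_x f (a * x + b)%R)%E.
Proof.
move=> a0 mf f0.
pose phi : measurableTypeR R -> measurableTypeR R := fun x => a * x + b.
have mphi : measurable_fun setT phi.
  by apply: measurable_funD => //; exact: measurable_funM.
(* The measure structure depends on the measurability of phi, which push takes
   as an argument. *)
pose push : {measure set (measurableTypeR R) -> \bar R} :=
  pushforward lebesgue_measure phi.
pose mu : {measure set (measurableTypeR R) -> \bar R} :=
  mscale (NngNum (normr_ge0 a)) (push mphi).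
have E A : measurable A -> lebesgue_measure A = mu A.
  apply: lebesgue_measure_unique => _ [[x y] _ <-] /=.
  rewrite /mu/= /mscale /push /= /pushforward.
  have [a_gt0|a_lt0|a_eq0] := ltgtP 0 a; last by rewrite a_eq0 eqxx in a0.
    rewrite (_ : phi @^-1` _ = `](x - b) / a, (y - b) / a]%classic); last first.
      apply/seteqP; split => t /=; rewrite /phi !in_itv/= ltr_pdivrMr// ler_pdivlMr//;
        by rewrite ltrBlDr lerBrDr mulrC.
    rewrite !lebesgue_measure_itv/= !lte_fin ltr_pM2r ?invr_gt0// ltrD2r.
    case: ifP => _; last by rewrite mule0.
    by rewrite -!EFinB -EFinM gtr0_norm//; congr EFin; field.
  rewrite (_ : phi @^-1` _ = `[(y - b) / a, (x - b) / a[%classic); last first.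
    apply/seteqP; split => t /=; rewrite /phi !in_itv/= ler_ndivrMr// ltr_ndivlMr//;
      by rewrite ltrBlDr lerBrDr mulrC andbC.
  rewrite !lebesgue_measure_itv/= !lte_fin ltr_nM2r ?invr_lt0// ltrD2r.
  case: ifP => _; last by rewrite mule0.
  by rewrite -!EFinB -EFinM ltr0_norm//; congr EFin; field.
rewrite (eq_measure_integral mu) => [|A mA _]; last exact: E.
rewrite ge0_integral_mscale//=.
by rewrite ge0_integral_pushforward//= => y _; exact: f0.
Qed.

Lemma ge0_integral_cons n (f : 'cV[R]_n.+1 -> \bar R) :
  measurable_fun setT f -> (forall x, (0 <= f x)%E) ->
  (\int[lebesgue_cV n.+1]_x f x =
   \int[lebesgue_measure]_s \int[lebesgue_cV n]_y f (consv (s, y)))%E.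
Proof.
move=> mf f0; rewrite /= /lebesgue_cons.
rewrite (@ge0_integral_pushforward _ _ _ _ _ _ (@measurable_consv R n))//.
rewrite preimage_setT (fubini_tonelli1 (f \o @consv R n))// => [|x]; last exact: f0.
by apply: measurableT_comp => //; exact: measurable_consv.
Qed.

Lemma ge0_integral_cons_swap n (f : 'cV[R]_n.+1 -> \bar R) :
  measurable_fun setT f -> (forall x, (0 <= f x)%E) ->
  (\int[lebesgue_cV n.+1]_x f x =
   \int[lebesgue_cV n]_y \int[lebesgue_measure]_s f (consv (s, y)))%E.
Proof.
move=> mf f0; rewrite ge0_integral_cons//.
rewrite (fubini_tonelli (f \o @consv R n))// => [|x]; last exact: f0.
by apply: measurableT_comp => //; exact: measurable_consv.
Qed.

Lemma measurable_fun_linear n (M : 'M[R]_n) (b : 'cV[R]_n) :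
  measurable_fun setT (fun x : 'cV[R]_n => M *m x + b).
Proof.
apply: measurable_fun_coord => i; under eq_fun do rewrite mxE mxE.
apply: measurable_funD => //; apply: measurable_sum => j.
by apply: measurable_funM => //; exact: measurable_coord.
Qed.

Lemma measurable_mulmx n (M : 'M[R]_n) :
  measurable_fun setT (fun x : 'cV[R]_n => M *m x).
Proof.
by have := measurable_fun_linear M 0; under eq_fun do rewrite addr0.
Qed.

Lemma measurable_addmx n (b : 'cV[R]_n) :
  measurable_fun setT (fun x : 'cV[R]_n => x + b).
Proof.
by have := measurable_fun_linear 1%:M b; under eq_fun do rewrite mul1mx.
Qed.

Lemma measurable_consv_tail n (s : R) : measurable_fun setT (fun y : 'cV[R]_n => consv (s, y)).
Proof.
apply: measurableT_comp; first exact: measurable_consv.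
by apply/measurable_fun_pairP; split => /=; [exact: measurable_cst|exact: measurable_id].
Qed.

Lemma measurable_consv_head n (y : 'cV[R]_n) :
  measurable_fun setT (fun s : measurableTypeR R => consv (s, y)).
Proof.
apply: measurableT_comp; first exact: measurable_consv.
by apply/measurable_fun_pairP; split => /=; [exact: measurable_id|exact: measurable_cst].
Qed.

Lemma consvD n (s t : R) (x y : 'cV[R]_n) :
  consv (s, x) + consv (t, y) = consv (s + t, x + y).
Proof. apply/colP => i; rewrite [0](_ : _ = ord0)//.
by have [j ->|->] := unliftP ord0 i; rewrite mxE ?consv_lift ?consv0//= mxE. Qed.

(** Translate one coordinate at a time. *)
Lemma has_jacobian_translation n (b : 'cV[R]_n) :
  has_jacobian 1 (fun x => x + b).
Proof.
elim: n b => [|n IHn] b.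
  split; first exact: measurable_addmx.
  move=> f mf f0; rewrite mul1e; congr integral; apply/funext => x.
  by congr f; apply/colP => -[].
split; first exact: measurable_addmx.
move=> f mf f0; rewrite mul1e ge0_integral_cons// [RHS]ge0_integral_cons//; last first.
  by apply: measurableT_comp => //; exact: measurable_addmx.
rewrite -(unconsvK b); case: (unconsv b) => t {}b.
under [RHS]eq_integral do under eq_integral do rewrite consvD.
have mF : measurable_fun setT (fun s : measurableTypeR R =>
    \int[lebesgue_cV n]_y f (consv (s, y)))%E.
  apply: (measurable_fun_fubini_tonelli_F (f \o @consv R n)) => //; last first.
    by move=> x; exact: f0.
  by apply: measurableT_comp => //; exact: measurable_consv.
rewrite (@lebesgue_affine 1 t)// ?oner_neq0//; last first.
  by move=> s; exact: integral_ge0.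
rewrite normr1 mul1e; apply: eq_integral => s _; rewrite mul1r.
have [_ ->] := IHn b; rewrite ?mul1e//.
by apply: measurableT_comp => //; exact: measurable_consv_tail.
Qed.

(** The first coordinate is integrated first: there, w *m y is only a
    translation. *)
Lemma has_jacobian_ublock n (a : R) (w : 'rV[R]_n) (D : 'M[R]_n) :
  a != 0 -> has_jacobian `|\det D| (fun x => D *m x) ->
  has_jacobian `|\det (block_mx a%:M w 0 D : 'M[R]_(1 + n)) |
    (fun x : 'cV_(1 + n) => block_mx a%:M w 0 D *m x).
Proof.
move=> a0 [mD HD]; split; first exact: (measurable_mulmx (n := n.+1)).
move=> f mf f0; rewrite ge0_integral_cons_swap//.
have mfc : measurable_fun setT (f \o @consv R n).
  by apply: measurableT_comp => //; exact: measurable_consv.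
rewrite [X in (_ * X)%E]ge0_integral_cons_swap//; last first.
  by apply: (measurableT_comp mf); exact: (measurable_mulmx (n := n.+1)).
have E s (y : 'cV[R]_n) : block_mx a%:M w 0 D *m consv (s, y) =
    consv (a * s + (w *m y) ord0 ord0, D *m y).
  rewrite /consv /= mul_block_col -scalar_mxM mul0mx add0r; congr col_mx.
  by rewrite raddfD/=; congr (_ + _); apply/matrixP => i j; rewrite !ord1 [RHS]mxE mulr1n.
under [X in (_ * X)%E]eq_integral do under eq_integral do rewrite E.
rewrite (HD (fun y => \int[lebesgue_measure]_s f (consv (s, y)))%E); last 2 first.
- by apply: (measurable_fun_fubini_tonelli_G (f \o @consv R n)) => // x; exact: f0.
- by move=> y; exact: integral_ge0.
rewrite det_ublock det_scalar1 normrM EFinM -muleA muleCA; congr (_ * _)%E.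
rewrite -ge0_integralZl//; last 2 first.
- apply: (measurable_fun_fubini_tonelli_G
    (fun p : measurableTypeR R * 'cV[R]_n => f (consv (a * p.1 + (w *m p.2) ord0 ord0, D *m p.2)))) => //.
  apply: (measurableT_comp mf); under eq_fun do rewrite -E.
  apply: measurableT_comp; first exact: (measurable_mulmx (n := n.+1)).
  by rewrite [X in measurable_fun _ X](_ : _ = @consv R n);
    [exact: measurable_consv|apply/funext => -[]].
- by move=> y _; exact: integral_ge0.
apply: eq_integral => y _.
rewrite (@lebesgue_affine a ((w *m y) ord0 ord0) (fun s => f (consv (s, D *m y))))//.
by apply: (measurableT_comp mf); exact: measurable_consv_head.
Qed.

(** The last n coordinates are integrated first: there, s *: v is only a
    translation. *)
Lemma has_jacobian_lblock n (a : R) (v : 'cV[R]_n) (D : 'M[R]_n) :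
  a != 0 -> has_jacobian `|\det D| (fun x => D *m x) ->
  has_jacobian `|\det (block_mx a%:M 0 v D : 'M[R]_(1 + n)) |
    (fun x : 'cV_(1 + n) => block_mx a%:M 0 v D *m x).
Proof.
move=> a0 [mD HD]; split; first exact: (measurable_mulmx (n := n.+1)).
move=> f mf f0; rewrite ge0_integral_cons//.
have mfc : measurable_fun setT (f \o @consv R n).
  by apply: measurableT_comp => //; exact: measurable_consv.
rewrite [X in (_ * X)%E]ge0_integral_cons//; last first.
  by apply: (measurableT_comp mf); exact: (measurable_mulmx (n := n.+1)).
have E (s : R) (y : 'cV[R]_n) : block_mx a%:M 0 v D *m consv (s, y) =
    consv (a * s, D *m y + s *: v).
  rewrite /consv /= mul_block_col -scalar_mxM mul0mx addr0; congr col_mx.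
  by rewrite mul_mx_scalar addrC.
under [X in (_ * X)%E]eq_integral do under eq_integral do rewrite E.
have mF : measurable_fun setT (fun s : measurableTypeR R =>
    \int[lebesgue_cV n]_y f (consv (s, y)))%E.
  by apply: (measurable_fun_fubini_tonelli_F (f \o @consv R n)) => // x; exact: f0.
rewrite (@lebesgue_affine a 0)//; last by move=> s; exact: integral_ge0.
rewrite det_lblock det_scalar1 normrM EFinM -muleA; congr (_ * _)%E.
rewrite -ge0_integralZl//; last 2 first.
- apply: (measurable_fun_fubini_tonelli_F
    (fun p : measurableTypeR R * 'cV[R]_n => f (consv (a * p.1, D *m p.2 + p.1 *: v)))) => //.
  apply: (measurableT_comp mf); under eq_fun do rewrite -E.
  apply: measurableT_comp; first exact: (measurable_mulmx (n := n.+1)).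
  by rewrite [X in measurable_fun _ X](_ : _ = @consv R n);
    [exact: measurable_consv|apply/funext => -[]].
- by move=> y _; exact: integral_ge0.
apply: eq_integral => s _; rewrite addr0.
have [_ ->] := has_jacobian_translation (s *: v) => //; last first.
  by apply: (measurableT_comp mf); exact: measurable_consv_tail.
rewrite mul1e HD//.
apply: (measurableT_comp (f := fun y => f (consv (a * s, y)))); last exact: measurable_addmx.
by apply: (measurableT_comp mf); exact: measurable_consv_tail.
Qed.

(** Induction on the dimension, using that every invertible matrix is a product
    of an upper, a lower and an upper block triangular one. *)
Lemma has_jacobian_mulmx n (M : 'M[R]_n) : M \in unitmx ->
  has_jacobian `|\det M| (fun x => M *m x).
Proof.
elim: n M => [|n IHn] M.
  move=> _; split; first exact: measurable_mulmx.
  move=> f mf f0; rewrite det_mx00 normr1 mul1e; congr integral; apply/funext => x.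
  by congr f; apply/colP => -[].
move=> uM.
(* a matrix whose top left entry is nonzero is a product of two block triangular ones *)
have corner (N : 'M[R]_(1 + n)) : N \in unitmx -> N ord0 ord0 != 0 ->
    has_jacobian `|\det N| (fun x : 'cV_(1 + n) => N *m x).
  move=> uN N0; rewrite -(submxK N).
  set a := N ord0 ord0 in N0.
  have -> : ulsubmx N = a%:M.
    apply/matrixP => i j; rewrite !ord1 !mxE mulr1n /a.
    by congr (N _ _); exact/val_inj.
  set w := ursubmx N; set v := dlsubmx N; set D := drsubmx N.
  pose S := D - v *m (a^-1 *: w).
  (* The Schur complement S is invertible along with N, which feeds the
     induction. *)
  have fac : block_mx a%:M w v D =
      block_mx 1%:M 0 (a^-1 *: v) 1%:M *m block_mx a%:M w 0 S.
    rewrite mulmx_block !mul1mx !mul0mx ?mulmx0 !addr0 mul_mx_scalar.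
    rewrite scalerA mulfV// scale1r /S -scalemxAl -scalemxAr.
    by rewrite addrC subrK.
  have uS : S \in unitmx.
    move: uN; rewrite !unitmxE -(submxK N) -/w -/v -/D.
    have -> : ulsubmx N = a%:M.
      apply/matrixP => i j; rewrite !ord1 !mxE mulr1n /a.
      by congr (N _ _); exact/val_inj.
    by rewrite fac det_mulmx det_lblock det_ublock !det1 !mul1r unitrM => /andP[].
  rewrite fac det_mulmx normrM.
  rewrite (_ : (fun _ => _) = (fun x : 'cV_(1 + n) => block_mx 1%:M 0 (a^-1 *: v) 1%:M *m x) \o
     (fun x => block_mx a%:M w 0 S *m x)); last first.
    by apply/funext => x /=; rewrite mulmxA.
  apply: has_jacobian_comp.
    by apply: has_jacobian_lblock; [exact: oner_neq0|apply: IHn; exact: unitmx1].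
  by apply: has_jacobian_ublock => //; exact: IHn.
have [M0|] := eqVneq (M ord0 ord0) 0; last exact: corner.
(* otherwise add to the first row another one that does not vanish in column 0 *)
have [i Mi] : exists i : 'I_n, M (lift ord0 i) ord0 != 0.
  apply/existsP; apply: contraT => /existsPn H.
  have : \det M = 0.
    rewrite (expand_det_col _ ord0) big1// => j _.
    have [k ->|->] := unliftP ord0 j; last by rewrite M0 mul0r.
    by have := H k; rewrite negbK => /eqP ->; rewrite mul0r.
  by move: uM; rewrite unitmxE unitfE => /eqP.
pose w : 'rV[R]_n := delta_mx ord0 i.
pose T (c : R) : 'M[R]_(1 + n) := block_mx 1%:M (c *: w) 0 1%:M.
have TK : T (-1) *m T 1 = 1%:M.
  rewrite /T mulmx_block !mul1mx !mulmx1 !mul0mx !mulmx0 !addr0 add0r.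
  by rewrite -scalerDl subrr scale0r -scalar_mx_block.
have TM : M = T (-1) *m (T 1 *m M) by rewrite mulmxA TK mul1mx.
have dT c : \det (T c) = 1 by rewrite det_ublock !det1 mul1r.
rewrite {1 2}TM det_mulmx normrM.
rewrite (_ : (fun _ => _) = (fun x : 'cV_(1 + n) => T (-1) *m x) \o
  (fun x => (T 1 *m M) *m x)); last first.
  by apply/funext => x /=; rewrite !mulmxA.
apply: has_jacobian_comp.
  apply: has_jacobian_ublock; first exact: oner_neq0.
  by apply: IHn; exact: unitmx1.
apply: corner.
  by move: uM; rewrite !unitmxE det_mulmx dT mul1r.
rewrite (_ : (T 1 *m M) ord0 ord0 = M (lift ord0 i) ord0)//.
rewrite mxE (_ : \sum_j _ = \sum_(j < 1 + n) T 1 ord0 j * M j ord0)//.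
rewrite big_split_ord/= big_ord1.
have -> : lshift n (ord0 : 'I_1) = ord0 by exact/val_inj.
rewrite M0 mulr0 add0r (bigD1 i)//= big1 => [|j ji].
  rewrite addr0.
  have -> : (ord0 : 'I_(1 + n)) = lshift n (ord0 : 'I_1) by exact/val_inj.
  rewrite /T block_mxEur !mxE !eqxx mulr1 mul1r.
  by congr (M _ _); exact/val_inj.
have {1}-> : (ord0 : 'I_(1 + n)) = lshift n (ord0 : 'I_1) by exact/val_inj.
by rewrite /T block_mxEur !mxE (negbTE ji) andbF mulr0 mul0r.
Qed.

End linear_change_of_variables.

Section jacobian_consequences.
Context {R : realType} {d : nat}.
Implicit Types (T : 'cV[R]_d -> 'cV[R]_d) (c : R).

Lemma has_jacobian_reflection (x : 'cV[R]_d) : has_jacobian 1 (fun y => x - y).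
Proof.
have -> : (fun y : 'cV[R]_d => x - y) = (fun y => y + x) \o (fun y => (-1)%:M *m y).
  by apply/funext => y /=; rewrite mul_scalar_mx scaleN1r addrC.
rewrite -[X in has_jacobian X]mulr1; apply: has_jacobian_comp.
  exact: has_jacobian_translation.
have := @has_jacobian_mulmx R d (-1)%:M.
rewrite unitmxE det_scalar normrX normrN1 expr1n; apply.
by rewrite unitrX// unitrN1.
Qed.

Lemma has_jacobian_integral c T (f : 'cV[R]_d -> \bar R) : 0 < c ->
  has_jacobian c T -> measurable_fun setT f ->
  (\int[lebesgue_cV d]_x f x = c%:E * \int[lebesgue_cV d]_x f (T x))%E.
Proof.
move=> c0 [mT HT] mf; rewrite [LHS]integralE [in RHS]integralE.
rewrite (HT (f^\+)%E)//; last exact: measurable_funepos.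
rewrite (HT (f^\-)%E)//; last exact: measurable_funeneg.
rewrite (_ : (fun x => f (T x))^\+%E = (fun x => f^\+ (T x))%E); last exact: funepos_comp.
rewrite (_ : (fun x => f (T x))^\-%E = (fun x => f^\- (T x))%E); last exact: funeneg_comp.
have : (0 <= \int[lebesgue_cV d]_x f^\+%E (T x))%E by apply: integral_ge0 => x _; exact: funepos_ge0.
have : (0 <= \int[lebesgue_cV d]_x f^\-%E (T x))%E by apply: integral_ge0 => x _; exact: funeneg_ge0.
case: (integral _ _ _) => [a| |]//; case: (integral _ _ _) => [b| |]// _ _.
- exact: (congr1 EFin (esym (mulrBr c b a))).
- by rewrite /= gt0_muley ?lte_fin.
- by rewrite /= gt0_muley ?lte_fin// gt0_muleNy ?lte_fin.
- by rewrite /= gt0_muley ?lte_fin// gt0_muleNy ?lte_fin.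
Qed.

Lemma has_jacobian_Rintegral c T (f : 'cV[R]_d -> R) : 0 < c ->
  has_jacobian c T -> measurable_fun setT f ->
  \int[lebesgue_cV d]_x f x = c * \int[lebesgue_cV d]_x f (T x).
Proof.
move=> c0 HT mf; rewrite /Rintegral (has_jacobian_integral c0 HT)//; last first.
  exact/measurable_EFinP.
case: integral => [a| |] //=.
- by rewrite gt0_muley ?lte_fin//= mulr0.
- by rewrite gt0_muleNy ?lte_fin//= mulr0.
Qed.

Lemma has_jacobian_ae c T (P : 'cV[R]_d -> Prop) : 0 < c -> has_jacobian c T ->
  {ae lebesgue_cV d, forall x, P x} -> {ae lebesgue_cV d, forall x, P (T x)}.
Proof.
move=> c0 [mT HT] [N [mN N0 PN]]; exists (T @^-1` N); split.
- by rewrite -[X in measurable X]setTI; exact: mT.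
- have mTN : measurable (T @^-1` N) by rewrite -[X in measurable X]setTI; exact: mT.
  have mi : measurable_fun setT (fun x : 'cV[R]_d => (\1_N x : R)%:E).
    by apply/measurable_EFinP; exact: measurable_indic.
  have i0 x : (0 <= (\1_N x : R)%:E)%E by rewrite lee_fin.
  have H := HT _ mi i0.
  rewrite (_ : (fun x => (\1_N (T x))%:E) = fun x => (\1_(T @^-1` N) x)%:E)// in H.
  rewrite !integral_indic// !setIT in H.
  have /eqP := etrans (esym H) N0.
  by rewrite mule_eq0 eqe gt_eqF//= => /eqP.
- by move=> x /= Px; apply: PN.
Qed.

End jacobian_consequences.

(** * Elementary inequalities for complex numbers *)

Section complex_modulus.
Context {R : realType}.
Implicit Types z w : R[i].
Local Notation normc := Normc.normc.
Local Notation Re := complex.Re.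
Local Notation Im := complex.Im.

Lemma normc_ge0 z : 0 <= normc z.
Proof. by case: z => a b; exact: sqrtr_ge0. Qed.

Lemma normc_sqr z : normc z ^+ 2 = Re z ^+ 2 + Im z ^+ 2.
Proof. by case: z => a b /=; rewrite sqr_sqrtr// addr_ge0// sqr_ge0. Qed.

Lemma normc_Re z : `|Re z| <= normc z.
Proof.
rewrite -(@ler_pXn2r _ 2%N)// ?nnegrE ?normc_ge0//.
by rewrite normc_sqr real_normK ?num_real// lerDl sqr_ge0.
Qed.

Lemma normc_Im z : `|Im z| <= normc z.
Proof.
rewrite -(@ler_pXn2r _ 2%N)// ?nnegrE ?normc_ge0//.
by rewrite normc_sqr real_normK ?num_real// lerDr sqr_ge0.
Qed.

Lemma normc_real (a : R) : normc (a%:C)%C = `|a|.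
Proof. by rewrite /= expr0n/= addr0 sqrtr_sqr. Qed.

Lemma Re_mul z w : Re (z * w) = Re z * Re w - Im z * Im w.
Proof. by case: z w => a b [c e]. Qed.

Lemma Im_mul z w : Im (z * w) = Re z * Im w + Im z * Re w.
Proof. by case: z w => a b [c e]. Qed.

Lemma Re_sub z w : Re (z - w) = Re z - Re w.
Proof. by case: z w => a b [c e]. Qed.

Lemma Im_sub z w : Im (z - w) = Im z - Im w.
Proof. by case: z w => a b [c e]. Qed.

Lemma Re_add z w : Re (z + w) = Re z + Re w.
Proof. by case: z w => a b [c e]. Qed.

Lemma Im_add z w : Im (z + w) = Im z + Im w.
Proof. by case: z w => a b [c e]. Qed.

Lemma ler_dist_normc z w : `|normc z - normc w| <= normc (z - w).
Proof.
rewrite ler_norml; apply/andP; split.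
  rewrite lerNl opprB lerBlDr -(normcN (z - w)) opprB.
  by apply: le_trans (le_normcD _ _); rewrite subrK.
by rewrite lerBlDr; apply: le_trans (le_normcD _ _); rewrite subrK.
Qed.

(** A quadratic substitute for the triangle inequality: contrary to the latter
    it can be summed over paths term by term, and nothing is lost since t is
    arbitrary. *)
Lemma sqrD_le_weighted (a b t : R) : 0 < t ->
  (a + b) ^+ 2 <= (1 + t) * a ^+ 2 + (1 + t^-1) * b ^+ 2.
Proof.
move=> t0; rewrite -subr_ge0.
have -> : (1 + t) * a ^+ 2 + (1 + t^-1) * b ^+ 2 - (a + b) ^+ 2 =
  (t * a - b) ^+ 2 / t by field; exact: lt0r_neq0.
by rewrite divr_ge0 ?sqr_ge0// ltW.
Qed.

Lemma normcD_sqr_weighted z w (t : R) : 0 < t ->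
  normc (z + w) ^+ 2 <= (1 + t) * normc z ^+ 2 + (1 + t^-1) * normc w ^+ 2.
Proof.
move=> t0; apply: le_trans (sqrD_le_weighted _ _ t0).
by rewrite ler_pXn2r ?nnegrE ?addr_ge0 ?normc_ge0// le_normcD.
Qed.

Lemma normc_parallelogram z w :
  normc (z + w) ^+ 2 + normc (z - w) ^+ 2 = 2 * normc z ^+ 2 + 2 * normc w ^+ 2.
Proof. by rewrite !normc_sqr Re_sub Im_sub Re_add Im_add; ring. Qed.

End complex_modulus.

(** * Square-integrable functions and their energy *)

Section energy.
Context {R : realType} {d : nat}.
Implicit Types f g : 'cV[R]_d -> R[i].
Local Notation normc := Normc.normc.
Local Notation mu := (@lebesgue_cV R d).

Definition energy f : \bar R := (\int[mu]_x (normc (f x) ^+ 2)%:E)%E.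

Lemma energyE f : (Lpnorm 2 f ^+ 2)%E = energy f.
Proof.
rewrite (_ : (_ ^+ 2)%E = Lpnorm 2 f `^ 2)%E; last first.
  have := Lpnorm_ge0 2 f; case: (Lpnorm 2 f) => [r| |]// r0.
    by rewrite poweR_EFin powR_mulrn// EFin_expe.
  by rewrite expe2 mulyy poweRyr ?pnatr_eq0.
rewrite /Lpnorm poweR_Lnorm ?pnatr_eq0//.
apply: eq_integral => x _.
by rewrite gee0_abs ?lee_fin ?normc_ge0// poweR_EFin powR_mulrn// normc_ge0.
Qed.

Lemma energy_ge0 f : (0 <= energy f)%E.
Proof. by apply: integral_ge0 => x _; rewrite lee_fin sqr_ge0. Qed.

Lemma Lpnorm1E f : Lpnorm 1 f = (\int[mu]_x (normc (f x))%:E)%E.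
Proof.
rewrite /Lpnorm Lnorm1; apply: eq_integral => x _.
by rewrite gee0_abs ?lee_fin ?normc_ge0.
Qed.

(** The transform acts on functions and its intermediate outputs are functions,
    so most of the argument takes place before passing to classes. *)
Definition inL2 f := cmeasurable f /\ (energy f < +oo)%E.

Lemma inL2P f : reflect (inL2 f) (f \in @sq_integrable R d).
Proof.
apply: (iffP (asboolP _)) => -[mf foo]; split=> //; move: foo; rewrite -energyE.
  by move=> foo; rewrite expe2 lte_mul_pinfty// ?Lpnorm_ge0// ge0_fin_numE ?Lpnorm_ge0.
have := Lpnorm_ge0 2 f.
by case: (Lpnorm 2 f) => [r| |] _; rewrite ?ltry// expe2 mulyy.
Qed.

Lemma measurable_normc_sqr f : cmeasurable f ->
  measurable_fun setT (fun x => (normc (f x) ^+ 2)%:E).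
Proof.
by move=> mf; apply/measurable_EFinP; apply: measurable_funX; exact: measurable_normc.
Qed.

Lemma cmeasurableB f g : cmeasurable f -> cmeasurable g -> cmeasurable (f - g).
Proof. by move=> mf mg; apply: cmeasurableD => //; exact: cmeasurableN. Qed.

Lemma cmeasurable_modulus f : cmeasurable f -> cmeasurable (modulus f).
Proof.
by move=> mf; split; [exact: measurable_normc|exact: measurable_cst].
Qed.

Lemma energy_modulus f : energy (modulus f) = energy f.
Proof.
by apply: eq_integral => x _; rewrite /modulus normc_real ger0_norm// normc_ge0.
Qed.

Lemma energyN f : energy (- f) = energy f.
Proof. by apply: eq_integral => x _; rewrite fctE normcN. Qed.

Lemma energy_ae f g : cmeasurable f -> cmeasurable g ->
  f = g %[ae mu] -> energy f = energy g.
Proof. by move=> mf mg fg; rewrite -!energyE (Lpnorm_ae 2 mf mg fg). Qed.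

Lemma inL2_modulus f : inL2 f -> inL2 (modulus f).
Proof.
by move=> [mf foo]; split; [exact: cmeasurable_modulus|rewrite energy_modulus].
Qed.

Lemma energyD_weighted f g (t : R) : 0 < t -> cmeasurable f -> cmeasurable g ->
  (energy (f + g)%R <= (1 + t)%:E * energy f + (1 + t^-1)%:E * energy g)%E.
Proof.
move=> t0 mf mg; have mf2 := measurable_normc_sqr mf; have mg2 := measurable_normc_sqr mg.
have t1 : 0 <= 1 + t by rewrite addr_ge0// ltW.
have t2 : 0 <= 1 + t^-1 by rewrite addr_ge0// invr_ge0 ltW.
rewrite /energy -ge0_integralZl//; last by move=> x _; rewrite lee_fin sqr_ge0.
rewrite -ge0_integralZl//; last by move=> x _; rewrite lee_fin sqr_ge0.
rewrite -ge0_integralD//; first last.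
- exact: measurable_funeM.
- by move=> x _; rewrite mule_ge0// lee_fin ?sqr_ge0.
- exact: measurable_funeM.
- by move=> x _; rewrite mule_ge0// lee_fin ?sqr_ge0.
apply: ge0_le_integral => //.
- by move=> x _; rewrite lee_fin sqr_ge0.
- by apply: measurable_normc_sqr; exact: cmeasurableD.
- by apply: emeasurable_funD; exact: measurable_funeM.
- by move=> x _; rewrite -!EFinM -EFinD lee_fin; exact: normcD_sqr_weighted.
Qed.

Lemma inL2D f g : inL2 f -> inL2 g -> inL2 (f + g).
Proof.
move=> [mf foo] [mg goo]; split; first exact: cmeasurableD.
apply: le_lt_trans (energyD_weighted ltr01 mf mg) _.
by rewrite lte_add_pinfty// lte_mul_pinfty// lee_fin addr_ge0.
Qed.

Lemma inL2N f : inL2 f -> inL2 (- f).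
Proof. by move=> [mf foo]; split; [exact: cmeasurableN|rewrite energyN]. Qed.

Lemma inL2B f g : inL2 f -> inL2 g -> inL2 (f - g).
Proof. by move=> hf hg; apply: inL2D => //; exact: inL2N. Qed.

Lemma energy_parallelogram f g : cmeasurable f -> cmeasurable g ->
  (energy (f + g)%R + energy (f - g)%R = 2%:E * energy f + 2%:E * energy g)%E.
Proof.
move=> mf mg; have mf2 := measurable_normc_sqr mf; have mg2 := measurable_normc_sqr mg.
have mD := measurable_normc_sqr (cmeasurableD mf mg).
have mB := measurable_normc_sqr (cmeasurableB mf mg).
have ge f' (x : 'cV[R]_d) : [set: 'cV[R]_d] x -> (0 <= (normc (f' x : R[i]) ^+ 2)%:E)%E.
  by move=> _; rewrite lee_fin sqr_ge0.
rewrite /energy -!ge0_integralZl//; try exact: ge.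
rewrite -!ge0_integralD//; try exact: ge; try exact: measurable_funeM.
- by apply: eq_integral => x _; rewrite -!EFinM -!EFinD !fctE normc_parallelogram.
- by move=> x _; rewrite mule_ge0// lee_fin ?sqr_ge0.
- by move=> x _; rewrite mule_ge0// lee_fin ?sqr_ge0.
Qed.

(** The modulus is 1-Lipschitz. *)
Lemma energy_modulusB f g : cmeasurable f -> cmeasurable g ->
  (energy (modulus f - modulus g)%R <= energy (f - g)%R)%E.
Proof.
move=> mf mg; apply: ge0_le_integral => //.
- by move=> x _; rewrite lee_fin sqr_ge0.
- by apply: measurable_normc_sqr; apply: cmeasurableB; exact: cmeasurable_modulus.
- by apply: measurable_normc_sqr; exact: cmeasurableB.
- move=> x _; rewrite lee_fin ler_pXn2r ?nnegrE ?normc_ge0//.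
  rewrite !fctE /modulus (_ : (_ - _)%C = ((normc (f x) - normc (g x))%:C)%C); last first.
    by rewrite raddfB.
  by rewrite normc_real ler_dist_normc.
Qed.

End energy.

(** * Convolution of square-integrable functions *)

Section convolution_L2.
Context {R : realType} {d : nat}.
Implicit Types (f g h : 'cV[R]_d -> R[i]) (x y : 'cV[R]_d).
Local Notation normc := Normc.normc.
Local Notation Re := complex.Re.
Local Notation Im := complex.Im.
Local Notation mu := (@lebesgue_cV R d).

Lemma cmeasurable_comp f (T : 'cV[R]_d -> 'cV[R]_d) : cmeasurable f ->
  measurable_fun setT T -> cmeasurable (f \o T).
Proof.
by move=> [mRe mIm] mT; split; [exact: (measurableT_comp mRe mT)|exact: (measurableT_comp mIm mT)].
Qed.

Lemma cmeasurableM f g : cmeasurable f -> cmeasurable g ->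
  cmeasurable (fun x => f x * g x).
Proof.
move=> [mRe mIm] [mRe' mIm']; split.
  under eq_fun do rewrite Re_mul.
  by apply: measurable_funB; exact: measurable_funM.
under eq_fun do rewrite Im_mul.
by apply: measurable_funD; exact: measurable_funM.
Qed.

Lemma has_jacobian_energy (c : R) (T : 'cV[R]_d -> 'cV[R]_d) f :
  has_jacobian c T -> cmeasurable f -> (energy f = c%:E * energy (f \o T))%E.
Proof.
move=> [mT HT] mf; rewrite /energy HT//; first exact: measurable_normc_sqr.
by move=> x; rewrite lee_fin sqr_ge0.
Qed.

Lemma inL2_reflect g x : inL2 g -> inL2 (fun y => g (x - y)).
Proof.
move=> [mg goo]; have [mT _] := has_jacobian_reflection x.
split; first exact: (cmeasurable_comp mg mT).
by rewrite (has_jacobian_energy (has_jacobian_reflection x) mg) mul1e in goo.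
Qed.

(** By 2 a b <= a^2 + b^2. *)
Lemma integrable_mul_inL2 f g : inL2 f -> inL2 g ->
  mu.-integrable setT (EFin \o fun y => normc (f y) * normc (g y)).
Proof.
move=> [mf foo] [mg goo].
apply: (@le_integrable _ _ _ mu _ measurableT _
  (fun y => (normc (f y) ^+ 2)%:E + (normc (g y) ^+ 2)%:E)%E).
- by apply/measurable_EFinP; apply: measurable_funM; exact: measurable_normc.
- move=> y _ /=; rewrite lee_fin !ger0_norm ?addr_ge0 ?sqr_ge0 ?mulr_ge0 ?normc_ge0//.
  have := sqr_ge0 (normc (f y) - normc (g y)).
  have := mulr_ge0 (normc_ge0 (f y)) (normc_ge0 (g y)).
  set a := normc _; set b := normc _; rewrite sqrrB; lra.
apply: integrableD => //; apply/integrableP; split; try exact: measurable_normc_sqr.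
  by under eq_integral do rewrite gee0_abs ?lee_fin ?sqr_ge0//.
by under eq_integral do rewrite gee0_abs ?lee_fin ?sqr_ge0//.
Qed.

Lemma integrable_Re_mul f g : inL2 f -> inL2 g ->
  mu.-integrable setT (EFin \o fun y => Re (f y * g y)).
Proof.
move=> hf hg; apply: le_integrable (integrable_mul_inL2 hf hg) => //.
  by apply/measurable_EFinP; exact: (cmeasurableM hf.1 hg.1).1.
move=> y _ /=; rewrite lee_fin -Normc.normcM (ger0_norm (normc_ge0 _)).
exact: normc_Re.
Qed.

Lemma integrable_Im_mul f g : inL2 f -> inL2 g ->
  mu.-integrable setT (EFin \o fun y => Im (f y * g y)).
Proof.
move=> hf hg; apply: le_integrable (integrable_mul_inL2 hf hg) => //.
  by apply/measurable_EFinP; exact: (cmeasurableM hf.1 hg.1).2.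
move=> y _ /=; rewrite lee_fin -Normc.normcM (ger0_norm (normc_ge0 _)).
exact: normc_Im.
Qed.

Lemma convolutionB f g h : inL2 f -> inL2 g -> inL2 h ->
  convolution (f - g) h = convolution f h - convolution g h.
Proof.
move=> hf hg hh; apply/funext => x; rewrite fctE.
have hx := inL2_reflect x hh; apply/eqP; rewrite eq_complex; apply/andP; split; apply/eqP.
  rewrite Re_sub /convolution /= -RintegralB//; try exact: integrable_Re_mul hx.
  by apply: eq_Rintegral => y _; rewrite fctE mulrBl Re_sub.
rewrite Im_sub /convolution /= -RintegralB//; try exact: integrable_Im_mul hx.
by apply: eq_Rintegral => y _; rewrite fctE mulrBl Im_sub.
Qed.

(** Each value of a convolution is an integral, hence the equality holds
    everywhere and not only almost everywhere. *)
Lemma eq_convolution_ae f f' g g' :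
  cmeasurable f -> cmeasurable f' -> cmeasurable g -> cmeasurable g' ->
  f = f' %[ae mu] -> g = g' %[ae mu] -> convolution f g = convolution f' g'.
Proof.
move=> mf mf' mg mg' ff' gg'; apply/funext => x.
have HT := has_jacobian_reflection x.
have mgx := cmeasurable_comp mg HT.1; have mgx' := cmeasurable_comp mg' HT.1.
have gx : {ae mu, forall y, g (x - y) = g' (x - y)}.
  apply: (has_jacobian_ae (P := fun y => g y = g' y) ltr01 HT).
  by apply: filterS gg' => y; exact.
rewrite /convolution /Rintegral; congr (fine _ +i* fine _)%C; apply: ae_eq_integral => //.
- by apply/measurable_EFinP; exact: (cmeasurableM mf mgx).1.
- by apply/measurable_EFinP; exact: (cmeasurableM mf' mgx').1.
- by apply: filterS2 ff' gx => y fy gy _; rewrite fy// gy.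
- by apply/measurable_EFinP; exact: (cmeasurableM mf mgx).2.
- by apply/measurable_EFinP; exact: (cmeasurableM mf' mgx').2.
- by apply: filterS2 ff' gx => y fy gy _; rewrite fy// gy.
Qed.

Lemma measurable_subv :
  measurable_fun [set: 'cV[R]_d * 'cV[R]_d] (fun p => p.1 - p.2).
Proof.
apply: measurable_fun_coord => i; under eq_fun do rewrite !mxE.
exact: (measurable_funB (measurableT_comp (measurable_coord i) measurable_fst)
  (measurableT_comp (measurable_coord i) measurable_snd)).
Qed.

(** Tonelli's theorem applies to the positive and to the negative part, which
    covers also the points where the integral diverges. *)
Lemma measurable_integral_param (F : 'cV[R]_d * 'cV[R]_d -> R) :
  measurable_fun setT F ->
  measurable_fun setT (fun x => \int[mu]_y F (x, y)).
Proof.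
move=> mF; have mE : measurable_fun setT (EFin \o F) by exact/measurable_EFinP.
rewrite /Rintegral; apply: measurableT_comp; first exact: fine_measurable.
under eq_fun do rewrite integralE.
apply: emeasurable_funB.
  rewrite (_ : (fun _ => _) = fun x => \int[mu]_y (EFin \o F)^\+%E (x, y))%E; last first.
    apply/funext => x; apply: eq_integral => y _.
    by rewrite (funepos_comp (EFin \o F) (fun y => (x, y))).
  apply: (measurable_fun_fubini_tonelli_F (EFin \o F)^\+%E) => //.
  exact: measurable_funepos.
rewrite (_ : (fun _ => _) = fun x => \int[mu]_y (EFin \o F)^\-%E (x, y))%E; last first.
  apply/funext => x; apply: eq_integral => y _.
  by rewrite (funeneg_comp (EFin \o F) (fun y => (x, y))).
apply: (measurable_fun_fubini_tonelli_F (EFin \o F)^\-%E) => //.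
exact: measurable_funeneg.
Qed.

Lemma measurable_convolution_integrand f g : cmeasurable f -> cmeasurable g ->
  measurable_fun [set: 'cV[R]_d * 'cV[R]_d] (fun p => Re (f p.2 * g (p.1 - p.2))) /\
  measurable_fun [set: 'cV[R]_d * 'cV[R]_d] (fun p => Im (f p.2 * g (p.1 - p.2))).
Proof.
move=> [fRe fIm] [gRe gIm].
have f1 : measurable_fun [set: 'cV[R]_d * 'cV[R]_d] (fun p => Re (f p.2)).
  exact: (measurableT_comp fRe measurable_snd).
have f2 : measurable_fun [set: 'cV[R]_d * 'cV[R]_d] (fun p => Im (f p.2)).
  exact: (measurableT_comp fIm measurable_snd).
have g1 := measurableT_comp gRe measurable_subv.
have g2 := measurableT_comp gIm measurable_subv.
split.
  by under eq_fun do rewrite Re_mul; apply: measurable_funB; exact: measurable_funM.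
by under eq_fun do rewrite Im_mul; apply: measurable_funD; exact: measurable_funM.
Qed.

Lemma cmeasurable_convolution f g : cmeasurable f -> cmeasurable g ->
  cmeasurable (convolution f g).
Proof.
move=> mf mg; have [mRe mIm] := measurable_convolution_integrand mf mg.
split; first exact: (measurable_integral_param mRe).
exact: (measurable_integral_param mIm).
Qed.

End convolution_L2.

(** * Dilations *)

Section dilations.
Context {R : realType} {d : nat}.
Implicit Types (f g h : 'cV[R]_d -> R[i]) (x y : 'cV[R]_d) (A : 'M[R]_d).
Local Notation normc := Normc.normc.
Local Notation Re := complex.Re.
Local Notation Im := complex.Im.
Local Notation mu := (@lebesgue_cV R d).

Lemma Re_real_mul (a : R) (z : R[i]) : Re ((a%:C)%C * z) = a * Re z.
Proof. by rewrite Re_mul /= mul0r subr0. Qed.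

Lemma Im_real_mul (a : R) (z : R[i]) : Im ((a%:C)%C * z) = a * Im z.
Proof. by rewrite Im_mul /= mul0r addr0. Qed.

Lemma cmeasurable_scale (a : R) f : cmeasurable f ->
  cmeasurable (fun x => (a%:C)%C * f x).
Proof.
move=> [mRe mIm]; split.
  by under eq_fun do rewrite Re_real_mul; exact: measurable_funM.
by under eq_fun do rewrite Im_real_mul; exact: measurable_funM.
Qed.

Lemma energy_scale (a : R) f : cmeasurable f ->
  energy (fun x => (a%:C)%C * f x) = ((a ^+ 2)%:E * energy f)%E.
Proof.
move=> mf; rewrite /energy -ge0_integralZl//; last 3 first.
- exact: measurable_normc_sqr.
- by move=> x _; rewrite lee_fin sqr_ge0.
- by rewrite lee_fin sqr_ge0.
apply: eq_integral => x _.
by rewrite Normc.normcM normc_real exprMn real_normK ?num_real// EFinM.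
Qed.

Lemma inL2_scale (a : R) f : inL2 f -> inL2 (fun x => (a%:C)%C * f x).
Proof.
move=> [mf foo]; split; first exact: cmeasurable_scale.
by rewrite energy_scale// lte_mul_pinfty// lee_fin sqr_ge0.
Qed.

Lemma norm_det_gt0 A : A \in unitmx -> 0 < `|\det A|.
Proof. by rewrite unitmxE unitfE normr_gt0. Qed.

Lemma cmeasurable_dilate p A f : cmeasurable f -> cmeasurable (dilate p A f).
Proof.
move=> mf; apply: cmeasurable_scale.
by apply: (cmeasurable_comp mf); exact: measurable_mulmx.
Qed.

Lemma dilate2_const_sqr A : A \in unitmx ->
  (`|\det A| `^ (2%:R)^-1) ^+ 2 = `|\det A|.
Proof.
by move=> uA; rewrite -powR_mulrn ?powR_ge0// -powRrM mulVf ?pnatr_eq0// powRr1.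
Qed.

Lemma energy_dilate2 A f : A \in unitmx -> cmeasurable f ->
  energy (dilate 2 A f) = energy f.
Proof.
move=> uA mf; rewrite energy_scale; last first.
  by apply: (cmeasurable_comp mf); exact: measurable_mulmx.
by rewrite dilate2_const_sqr// [RHS](has_jacobian_energy (has_jacobian_mulmx uA)).
Qed.

Lemma inL2_mulmx A f : A \in unitmx -> inL2 f -> inL2 (f \o mulmx A).
Proof.
move=> uA hf; have HT := has_jacobian_mulmx uA; have a0 := norm_det_gt0 uA.
split; first exact: (cmeasurable_comp hf.1 HT.1).
have := hf.2; rewrite (has_jacobian_energy HT hf.1).
have := energy_ge0 (f \o mulmx A); case: energy => [r| |]//= _; first by move=> _; rewrite ltry.
by rewrite gt0_muley ?lte_fin.
Qed.

Lemma inL2_dilate p A f : A \in unitmx -> inL2 f -> inL2 (dilate p A f).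
Proof. by move=> uA hf; apply: inL2_scale; exact: (inL2_mulmx uA). Qed.

Lemma modulus_dilate p A f : modulus (dilate p A f) = dilate p A (modulus f).
Proof.
apply/funext => x; rewrite /modulus /dilate Normc.normcM normc_real.
by rewrite ger0_norm ?powR_ge0// rmorphM.
Qed.

(** The substitution z = A *m y in the integral that defines the right-hand
    side. The equality holds at every point. *)
Lemma convolution_dilate A f g : A \in unitmx -> inL2 f -> inL2 g ->
  convolution (dilate 2 A f) g =
  dilate 2 A (convolution f (dilate 1 (invmx A) g)).
Proof.
move=> uA hf hg; apply/funext => x.
have a0 := norm_det_gt0 uA; have HT := has_jacobian_mulmx uA.
have hfA := inL2_mulmx uA hf.
have hgx := inL2_reflect x hg.
have mgi : cmeasurable (dilate 1 (invmx A) g) by apply: cmeasurable_dilate; exact: hg.1.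
have mint := measurable_convolution_integrand hf.1 mgi.
have mx : measurable_fun setT (fun y : 'cV[R]_d => (A *m x, y)).
  by apply/measurable_fun_pairP; split; [exact: measurable_cst|exact: measurable_id].
have E y : f (A *m y) * dilate 1 (invmx A) g (A *m x - A *m y) =
    (((`|\det A|^-1)%:C)%C * (f (A *m y) * g (x - y))).
  rewrite /dilate -mulmxBr mulKmx// det_inv normfV invr1 powRr1 ?invr_ge0 ?normr_ge0//.
  by rewrite mulrCA.
apply/eqP; rewrite eq_complex /dilate Re_real_mul Im_real_mul; apply/andP; split; apply/eqP => /=.
  rewrite [in RHS](has_jacobian_Rintegral a0 HT); last exact: (measurableT_comp mint.1 mx).
  under [in RHS]eq_Rintegral do rewrite E Re_real_mul.
  rewrite RintegralZl//; last exact: (integrable_Re_mul hfA hgx).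
  rewrite mulVKf ?gt_eqF// -RintegralZl//; last exact: (integrable_Re_mul hfA hgx).
  by apply: eq_Rintegral => y _; rewrite -mulrA Re_real_mul.
rewrite [in RHS](has_jacobian_Rintegral a0 HT); last exact: (measurableT_comp mint.2 mx).
under [in RHS]eq_Rintegral do rewrite E Im_real_mul.
rewrite RintegralZl//; last exact: (integrable_Im_mul hfA hgx).
rewrite mulVKf ?gt_eqF// -RintegralZl//; last exact: (integrable_Im_mul hfA hgx).
by apply: eq_Rintegral => y _; rewrite -mulrA Im_real_mul.
Qed.

(** Normalised in L^2, a dilation by a large matrix is small in L^1. *)
Lemma Lpnorm1_dilate2 A f : A \in unitmx -> cmeasurable f ->
  (Lpnorm 1 (dilate 2 A f) = (`|\det A| `^ (2%:R)^-1)^-1%:E * Lpnorm 1 f)%E.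
Proof.
move=> uA mf; rewrite !Lpnorm1E.
set c := _ `^ _; have c0 : 0 < c by rewrite powR_gt0// norm_det_gt0.
have mfn : measurable_fun setT (fun x => (normc (f x))%:E).
  by apply/measurable_EFinP; exact: measurable_normc.
have [mA HA] := has_jacobian_mulmx uA.
rewrite [in RHS]HA//; last by move=> x; rewrite lee_fin normc_ge0.
rewrite -(dilate2_const_sqr uA) -/c muleA -EFinM expr2 mulKf ?gt_eqF//.
rewrite -ge0_integralZl//; last 3 first.
- exact: (measurableT_comp mfn mA).
- by move=> x _; rewrite lee_fin normc_ge0.
- by rewrite lee_fin ltW.
by apply: eq_integral => x _; rewrite /dilate Normc.normcM normc_real ger0_norm ?ltW.
Qed.

End dilations.

(** * An inequality of Young type *)

Section young.
Context {R : realType} {d : nat}.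
Implicit Types (f g h : 'cV[R]_d -> R[i]) (x y : 'cV[R]_d).
Local Notation normc := Normc.normc.
Local Notation Re := complex.Re.
Local Notation Im := complex.Im.
Local Notation mu := (@lebesgue_cV R d).

Lemma cauchy_schwarz (a b : 'cV[R]_d -> R) :
  measurable_fun setT a -> measurable_fun setT b ->
  ((\int[mu]_y (`|a y * b y|)%:E) ^+ 2 <=
   (\int[mu]_y (a y ^+ 2)%:E) * (\int[mu]_y (b y ^+ 2)%:E))%E.
Proof.
move=> ma mb.
have L2E (u : 'cV[R]_d -> R) : ('N[mu]_2%:E[EFin \o u] ^+ 2 = \int[mu]_y (u y ^+ 2)%:E)%E.
  rewrite (_ : (_ ^+ 2)%E = 'N[mu]_2%:E[EFin \o u] `^ 2)%E; last first.
    have := Lnorm_ge0 mu 2%:E (EFin \o u).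
    case: (Lnorm _ _ _) => [r| |]// r0.
      by rewrite poweR_EFin powR_mulrn// EFin_expe.
    by rewrite expe2 mulyy poweRyr ?pnatr_eq0.
  rewrite poweR_Lnorm ?pnatr_eq0//; apply: eq_integral => y _ /=.
  by rewrite powR_mulrn// real_normK ?num_real.
have half2 : 2^-1 + 2^-1 = 1 :> R by field.
have := hoelder mu ma mb (ltr0n _ 2) (ltr0n _ 2) half2.
rewrite Lnorm1 -!L2E => H; rewrite !expe2 muleACA.
by apply: lee_pmul => //; apply: integral_ge0.
Qed.

(** The Cauchy-Schwarz inequality for the measure with density normc f; the
    factor 2 comes from the separate treatment of the real and imaginary parts. *)
Lemma normc_convolution_sqr f g x : inL2 f -> inL2 g ->
  ((normc (convolution f g x) ^+ 2)%:E <=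
   2%:E * ((\int[mu]_y (normc (f y))%:E) *
           (\int[mu]_y (normc (f y) * normc (g (x - y)) ^+ 2)%:E)))%E.
Proof.
move=> hf hg; have hgx := inL2_reflect x hg.
have iRe := integrable_Re_mul hf hgx; have iIm := integrable_Im_mul hf hgx.
have iN := integrable_mul_inL2 hf hgx.
pose I := \int[mu]_y (normc (f y) * normc (g (x - y))).
have I0 : 0 <= I.
  by apply: Rintegral_ge0 => y _; rewrite mulr_ge0 ?normc_ge0.
have leRe : `|\int[mu]_y Re (f y * g (x - y))| <= I.
  apply: le_trans (le_normr_Rintegral _ iRe) _ => //; apply: le_Rintegral => //.
    exact: integrable_norm.
  by move=> y _; rewrite -Normc.normcM normc_Re.
have leIm : `|\int[mu]_y Im (f y * g (x - y))| <= I.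
  apply: le_trans (le_normr_Rintegral _ iIm) _ => //; apply: le_Rintegral => //.
    exact: integrable_norm.
  by move=> y _; rewrite -Normc.normcM normc_Im.
apply: (@le_trans _ _ (2%:E * (I ^+ 2)%:E)%E).
  rewrite -EFinM lee_fin normc_sqr /= mulr_natl mulr2n.
  have sqr_le a : `|a| <= I -> a ^+ 2 <= I ^+ 2.
    by move=> aI; rewrite -(real_normK (num_real a)) lerXn2r// ?nnegrE.
  by apply: lerD; exact: sqr_le.
apply: lee_wpmul2l => //.
have mf := measurable_normc hf.1; have mg := measurable_normc hgx.1.
have msqrt : measurable_fun [set: R] (Num.sqrt : R -> R).
  by apply: continuous_measurable_fun; exact: sqrt_continuous.
have ms := measurableT_comp msqrt mf.
have := cauchy_schwarz ms (measurable_funM ms mg).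
under [in X in (_ <= X -> _)%E]eq_integral do
  rewrite /= sqr_sqrtr ?normc_ge0//.
under [X in (_ <= _ * X -> _)%E]eq_integral do
  rewrite /= exprMn sqr_sqrtr ?normc_ge0//.
under [X in (X ^+ 2 <= _ -> _)%E]eq_integral do
  rewrite /= mulrA -expr2 sqr_sqrtr ?normc_ge0// ger0_norm ?mulr_ge0 ?normc_ge0//.
apply: le_trans; rewrite EFin_expe le_eqVlt; apply/orP; left; apply/eqP.
congr (_ ^+ 2)%E; rewrite /I /Rintegral fineK//.
exact: integrable_fin_num.
Qed.

(** Young's inequality for L^1 and L^2, up to the factor 2. *)
Lemma energy_convolution_le f g : inL2 f -> inL2 g ->
  (energy (convolution f g) <= 2%:E * (Lpnorm 1 f * Lpnorm 1 f) * energy g)%E.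
Proof.
move=> hf hg; rewrite Lpnorm1E; set N := integral _ _ _.
have N0 : (0 <= N)%E by apply: integral_ge0 => y _; rewrite lee_fin normc_ge0.
have mf := measurable_normc hf.1; have mg := measurable_normc hg.1.
pose F (p : 'cV[R]_d * 'cV[R]_d) : \bar R :=
  (normc (f p.2) * normc (g (p.1 - p.2)) ^+ 2)%:E.
have mF : measurable_fun setT F.
  apply/measurable_EFinP; apply: measurable_funM.
    exact: (measurableT_comp mf measurable_snd).
  by apply: measurable_funX; exact: (measurableT_comp mg measurable_subv).
have F0 p : (0 <= F p)%E by rewrite lee_fin mulr_ge0 ?normc_ge0 ?sqr_ge0.
have -> : (2%:E * (N * N) * energy g =
    \int[mu]_x (2%:E * (N * \int[mu]_y F (x, y))))%E.
  have mI := measurable_fun_fubini_tonelli_F F mF F0 (m2 := mu).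
  have I0 x : (0 <= \int[mu]_y F (x, y))%E by exact: integral_ge0.
  rewrite ge0_integralZl//; last 2 first.
  - exact: emeasurable_funM.
  - by move=> x _; rewrite mule_ge0.
  rewrite -!muleA; congr (_ * _)%E; rewrite ge0_integralZl//; congr (_ * _)%E.
  rewrite (fubini_tonelli F)//= muleC -ge0_integralZl//; last 3 first.
  - exact/measurable_EFinP.
  - by move=> y _; rewrite lee_fin normc_ge0.
  - exact: energy_ge0.
  apply: eq_integral => y _.
  rewrite /F /= muleC.
  under [RHS]eq_integral do rewrite EFinM.
  have mgy : measurable_fun setT (fun x => (normc (g (x - y)) ^+ 2)%:E).
    apply: measurable_normc_sqr.
    by apply: (cmeasurable_comp hg.1); exact: measurable_addmx.
  rewrite ge0_integralZl//; last 2 first.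
  - by move=> x _; rewrite lee_fin sqr_ge0.
  - by rewrite lee_fin normc_ge0.
  by rewrite (has_jacobian_energy (has_jacobian_translation (- y)) hg.1) mul1e.
apply: ge0_le_integral => //.
- by move=> x _; rewrite lee_fin sqr_ge0.
- by apply: measurable_normc_sqr; apply: cmeasurable_convolution; [exact: hf.1|exact: hg.1].
- do 2 apply: emeasurable_funM => //.
  exact: (measurable_fun_fubini_tonelli_F F mF F0 (m2 := mu)).
- by move=> x _; exact: normc_convolution_sqr.
Qed.

End young.

(** * Singular values and the determinant *)

Section singular_values.
Context {R : realType} {d : nat}.
Implicit Types A : 'M[R]_d.

(** For v an eigenvector, the squared norm of v *m A^T is z times that of v. *)
Lemma gram_eigenvalue_ge0 A (z : R[i]) :
  eigenvalue (map_mx (real_complex R) (A^T *m A)) z -> 0 <= z.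
Proof.
move=> /eigenvalueP[v vz v0].
pose B := map_mx (real_complex R) A.
pose w := v *m B^T.
have conjB k j : (B k j)^* = B k j by rewrite /B mxE; apply/CrealP; rewrite complex_real.
have P : \sum_j (z *: v) ord0 j * (v ord0 j)^* = \sum_k w ord0 k * (w ord0 k)^*.
  rewrite -vz map_mxM -map_trmx -/B mulmxA -/w.
  under eq_bigr do rewrite mxE big_distrl/=.
  rewrite exchange_big/=; apply: eq_bigr => k _.
  under eq_bigr do rewrite -mulrA.
  rewrite -big_distrr/=; congr (_ * _).
  rewrite /w mxE rmorph_sum/=; apply: eq_bigr => j _.
  by rewrite rmorphM/= [in RHS]mxE conjB mulrC.
have Q0 : 0 < \sum_j v ord0 j * (v ord0 j)^*.
  rewrite lt0r sumr_ge0 ?andbT; last by move=> j _; exact: mul_conjC_ge0.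
  apply: contra v0; rewrite psumr_eq0; last by move=> j _; exact: mul_conjC_ge0.
  move=> /allP v0; apply/eqP/rowP => j; rewrite [RHS]mxE.
  by have := v0 j; rewrite mem_index_enum mul_conjC_eq0 => /(_ isT)/eqP.
rewrite -(pmulr_lge0 _ Q0) mulr_sumr.
rewrite (_ : \sum_i _ = \sum_k w ord0 k * (w ord0 k)^*).
  by apply: sumr_ge0 => k _; exact: mul_conjC_ge0.
by rewrite -P; apply: eq_bigr => j _; rewrite mxE mulrA.
Qed.

Lemma sigma_min_ge0 A : 0 <= sigma_min A.
Proof.
rewrite /sigma_min; have [->|/set0P S0] := eqVneq [set s | singular_value A s] set0.
  by rewrite inf0.
by apply: lb_le_inf => // _ [a _ ->]; exact: sqrtr_ge0.
Qed.

Lemma sigma_min_le A s : singular_value A s -> sigma_min A <= s.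
Proof.
by move=> As; apply: ge_inf => //; exists 0 => _ [a _ ->]; exact: sqrtr_ge0.
Qed.

(** The square of det A is the product of the eigenvalues of A^T *m A. These are
    the roots of a characteristic polynomial that splits over the complex
    numbers; they are real and nonnegative, so that their square roots are
    singular values of A. *)
Lemma sigma_min_det A : sigma_min A ^+ d <= `|\det A|.
Proof.
rewrite -(@ler_pXn2r _ 2%N) ?nnegrE ?exprn_ge0 ?sigma_min_ge0//.
rewrite real_normK ?num_real// [leRHS]expr2 -{1}(det_tr A) -det_mulmx.
set G := A^T *m A; pose GC := map_mx (real_complex R) G.
have [rs Ers] := closed_field_poly_normal (char_poly GC).
rewrite (monicP (char_poly_monic GC)) scale1r in Ers.
have size_rs : size rs = d.
  by apply: succn_inj; rewrite -(size_char_poly GC) Ers size_prod_XsubC.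
have detG : (real_complex R (\det G)) = \prod_(z <- rs) z.
  rewrite -det_map_mx -/GC.
  have := congr1 (fun p => p.[0]) Ers.
  rewrite horner_coef0 char_poly_det horner_prod.
  under eq_bigr do rewrite hornerXsubC sub0r -mulN1r.
  rewrite big_split/= big_const_seq count_predT size_rs iter_mulr_1.
  by move/mulfI; apply; rewrite expf_neq0// oppr_eq0 oner_neq0.
have rsP z : z \in rs -> exists2 a : R, z = real_complex R a & sigma_min A ^+ 2 <= a.
  move=> zrs; have ez : eigenvalue GC z.
    by rewrite eigenvalue_root_char Ers root_prod_XsubC.
  have z0 := gram_eigenvalue_ge0 ez.
  have zE : z = real_complex R (complex.Re z).
    by case: z z0 {zrs ez} => a b; rewrite lecE/= => /andP[/eqP -> _].
  exists (complex.Re z) => //.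
  have Rez0 : 0 <= complex.Re z by move: z0; rewrite lecE/= => /andP[].
  rewrite -(sqr_sqrtr Rez0) lerXn2r ?nnegrE ?sigma_min_ge0 ?sqrtr_ge0//.
  apply: sigma_min_le; exists (complex.Re z) => //.
  move: ez; rewrite !eigenvalue_root_char zE -map_char_poly fmorph_root.
  by rewrite -/G.
suff : real_complex R ((sigma_min A ^+ 2) ^+ size rs) <= \prod_(z <- rs) z.
  rewrite -detG size_rs -exprM mulnC exprM lecR; exact.
elim: rs rsP {Ers size_rs detG} => [|z rs IH] rsP; first by rewrite big_nil expr0.
rewrite big_cons [size _]/= exprS (rmorphM (real_complex R)); apply: ler_pM.
- by rewrite lecR sqr_ge0.
- by rewrite lecR exprn_ge0// sqr_ge0.
- by have [|a -> sa] := rsP z; rewrite ?mem_head// lecR.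
- by apply: IH => y yrs; apply: rsP; rewrite in_cons yrs orbT.
Qed.

Lemma det_dvg (A : nat -> 'M[R]_d) : (0 < d)%N ->
  sigma_min (A m) @[m --> \oo] --> +oo -> `|\det (A m)| @[m --> \oo] --> +oo.
Proof.
move=> d0 As; apply/cvgryPge => M.
near=> m; have sM : Num.max M 1 <= sigma_min (A m).
  by near: m; move/cvgryPge : As; exact.
apply: le_trans (sigma_min_det _).
have : 1 <= sigma_min (A m) by apply: le_trans sM; rewrite le_max lexx orbT.
move=> s1; apply: (@le_trans _ _ (sigma_min (A m))).
  by apply: le_trans sM; rewrite le_max lexx.
by rewrite -[leLHS]expr1; apply: ler_weXn2l.
Unshelve. all: by end_near. Qed.

End singular_values.

(** * Vanishing of the low-pass output under dilation *)

Lemma cvge0P {R : realType} (u : nat -> \bar R) : (forall n, (0 <= u n)%E) ->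
  (u n @[n --> \oo] --> 0%E) <->
  (forall e : R, 0 < e -> \forall n \near \oo, (u n <= e%:E)%E).
Proof.
move=> u0; split=> [/fine_cvgP[ufin /cvgrPdist_le uc] e e0|ule].
  near=> n; have /fineK <- : u n \is a fin_num by near: n.
  rewrite lee_fin; have : `|0 - fine (u n)| <= e by near: n; exact: uc.
  by rewrite sub0r normrN ger0_norm// fine_ge0.
apply/fine_cvgP; split.
  by apply: filterS (ule 1 ltr01) => n un; rewrite ge0_fin_numE// (le_lt_trans un) ?ltry.
apply/cvgrPdist_le => e e0; apply: filterS (ule e e0) => n un /=.
rewrite sub0r normrN ger0_norm ?fine_ge0//.
by have := u0 n; move: un; case: (u n) => [r| |]//=; rewrite ?lee_fin.
Unshelve. all: by end_near. Qed.

Section lowpass.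
Context {R : realType} {d : nat}.
Implicit Types (f g h : 'cV[R]_d -> R[i]) (x y : 'cV[R]_d).
Local Notation normc := Normc.normc.
Local Notation mu := (@lebesgue_cV R d).

(** Truncation to the sets where normc f >= 1/(n+1): there normc f <= (n+1)
    (normc f)^2, whence integrability, and the remainder tends to 0 by dominated
    convergence. *)
Lemma L1_dense_L2 f (e : R) : inL2 f -> 0 < e ->
  exists g, [/\ inL2 g, (Lpnorm 1 g < +oo)%E & (energy (f - g)%R <= e%:E)%E].
Proof.
move=> [mf foo] e0; have mnf := measurable_normc mf.
pose E n := [set x | n.+1%:R^-1 <= normc (f x)].
have mE n : measurable (E n).
  rewrite (_ : E n = setT `&` [set x | n.+1%:R^-1 <= normc (f x)]); last by rewrite setTI.
  by apply: (measurable_fun_le measurableT) => //; exact: measurable_cst.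
pose ind n x : R[i] := ((\1_(E n) x)%:C)%C.
have mind n : cmeasurable (ind n).
  by split; [exact: measurable_indic|exact: measurable_cst].
pose g n x := ind n x * f x.
have mg n : cmeasurable (g n) by exact: cmeasurableM.
have nfgE n x : normc ((f - g n) x) = (1 - \1_(E n) x) * normc (f x).
  rewrite !fctE /g (_ : f x - _ = ((1 - \1_(E n) x)%:C)%C * f x); last first.
    by rewrite rmorphB rmorph1 mulrBl mul1r.
  rewrite Normc.normcM normc_real ger0_norm// subr_ge0 indicE.
have tail : energy (f - g n) @[n --> \oo] --> 0%E.
  have := @dominated_convergence _ _ R mu setT measurableT
    (fun n x => (normc ((f - g n) x) ^+ 2)%:E) (cst 0%E) (fun x => (normc (f x) ^+ 2)%:E).
  case.
  - by move=> n; apply: measurable_normc_sqr; exact: cmeasurableB.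
  - exact: measurable_cst.
  - apply: aeW => x _; apply: cvg_near_cst.
    have [fx0|fx0] := eqVneq (normc (f x)) 0.
      by apply: nearW => n; rewrite nfgE fx0 mulr0 expr0n.
    have fx_gt0 : 0 < normc (f x) by rewrite lt0r fx0 normc_ge0.
    near=> n; rewrite nfgE indicE mem_set ?subrr ?mul0r ?expr0n//.
    rewrite /E /= ltW//.
    by near: n; exact: near_infty_natSinv_lt (PosNum fx_gt0).
  - apply/integrableP; split; first exact: measurable_normc_sqr.
    by under eq_integral do rewrite gee0_abs ?lee_fin ?sqr_ge0//.
  - apply: aeW => x n _ /=; rewrite lee_fin ger0_norm ?sqr_ge0// nfgE.
    rewrite lerXn2r ?nnegrE ?normc_ge0// ?mulr_ge0 ?normc_ge0//.
    by rewrite ler_piMl ?normc_ge0// indicE; case: (x \in E n); rewrite ?subrr ?subr0.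
  by move=> _ _; rewrite integral_cst// mul0e.
have [n fgn] : exists n, (energy (f - g n)%R <= e%:E)%E.
  have /cvge0P H := tail.
  have [N _ HN] := H (fun n => energy_ge0 _) e e0.
  by exists N; exact: HN (leqnn N).
exists (g n); split=> //.
- split => //.
  apply: le_lt_trans foo; apply: ge0_le_integral => //.
  + by move=> x _; rewrite lee_fin sqr_ge0.
  + exact: measurable_normc_sqr.
  + exact: measurable_normc_sqr.
  + move=> x _; rewrite lee_fin lerXn2r ?nnegrE ?normc_ge0// Normc.normcM normc_real.
    by rewrite ger0_norm// ler_piMl ?normc_ge0// indicE; case: (x \in E n).
- rewrite Lpnorm1E; apply: (@le_lt_trans _ _ (n.+1%:R%:E * energy f)%E).
    rewrite -ge0_integralZl//; last 2 first.
    + exact: measurable_normc_sqr.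
    + by move=> x _; rewrite lee_fin sqr_ge0.
    apply: ge0_le_integral => //.
    + by move=> x _; rewrite lee_fin normc_ge0.
    + by apply/measurable_EFinP; exact: measurable_normc.
    + by apply: measurable_funeM; exact: measurable_normc_sqr.
    + move=> x _; rewrite -EFinM lee_fin Normc.normcM normc_real ger0_norm//.
      rewrite indicE; have [xE|xE] := boolP (x \in E n); last first.
        by rewrite mul0r mulr_ge0// sqr_ge0.
      rewrite mul1r expr2 mulrA ler_peMl ?normc_ge0//.
      by move: xE; rewrite inE /E /= -ler_pdivrMl// mulr1.
  by rewrite lte_mul_pinfty.
Unshelve. all: by end_near. Qed.

Lemma dilateB p (A : 'M[R]_d) f g : dilate p A (f - g) = dilate p A f - dilate p A g.
Proof. by apply/funext => x; rewrite /dilate !fctE mulrBr. Qed.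

(** For f in L^1 this is Young's inequality, the L^1 norm of the dilated
    function being O(|det A_m|^(-1/2)). The uniform bound by the energy of f
    reduces the general case to this one. *)
Lemma lowpass_dilate_cvg0 (chi : 'cV[R]_d -> R[i]) (A : nat -> 'M[R]_d) f :
  inL2 chi ->
  (forall g, inL2 g -> (energy (convolution g chi) <= energy g)%E) ->
  (forall m, A m \in unitmx) ->
  `|\det (A m)| @[m --> \oo] --> +oo ->
  inL2 f -> energy (convolution (dilate 2 (A m) f) chi) @[m --> \oo] --> 0%E.
Proof.
move=> hchi chi_le uA detA hf.
have chi_fin : energy chi \is a fin_num.
  by rewrite ge0_fin_numE ?energy_ge0//; exact: hchi.2.
apply/cvge0P => [m|e e0]; first exact: energy_ge0.
have e4 : 0 < e / 4 by rewrite divr_gt0.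
have [g [hg g1 fg]] := L1_dense_L2 hf e4.
have g1_fin : Lpnorm 1 g \is a fin_num by rewrite ge0_fin_numE ?Lpnorm_ge0.
(* Collects the constants: the truncated function contributes at most K / |det
   (A m)| to the total. *)
pose K := 4 * (fine (Lpnorm 1 g) ^+ 2 * fine (energy chi)).
near=> m.
have hDf := inL2_dilate 2 (uA m) hf; have hDg := inL2_dilate 2 (uA m) hg.
have -> : dilate 2 (A m) f = (dilate 2 (A m) f - dilate 2 (A m) g) + dilate 2 (A m) g.
  by rewrite subrK.
rewrite -[X in convolution (_ + X)]opprK convolutionB//; [|exact: inL2B|exact: inL2N].
have hcD : inL2 (convolution (dilate 2 (A m) f - dilate 2 (A m) g) chi).
  have hfg := inL2B hDf hDg; split; first exact: cmeasurable_convolution hfg.1 hchi.1.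
  by apply: le_lt_trans (chi_le _ hfg) hfg.2.
have mcN : cmeasurable (convolution (- dilate 2 (A m) g) chi).
  by apply: cmeasurable_convolution; [exact: (inL2N hDg).1|exact: hchi.1].
apply: le_trans (energyD_weighted ltr01 hcD.1 (cmeasurableN mcN)) _.
rewrite invr1 energyN -dilateB.
apply: (@le_trans _ _ (2%:E * (e / 4)%:E + 2%:E * (e / 4)%:E)%E); last first.
  by rewrite -!EFinM -EFinD lee_fin; lra.
apply: leeD; apply: lee_wpmul2l => //.
  apply: le_trans (chi_le _ _) _; first by apply: inL2_dilate => //; exact: inL2B.
  by rewrite energy_dilate2//; exact: (inL2B hf hg).1.
apply: le_trans (energy_convolution_le (inL2N hDg) hchi) _.
have -> : Lpnorm 1 (- dilate 2 (A m) g) = Lpnorm 1 (dilate 2 (A m) g) by exact: LpnormN.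
rewrite Lpnorm1_dilate2//; last exact: hg.1.
set c := _ `^ _.
have c2 : c ^+ 2 = `|\det (A m)| by exact: dilate2_const_sqr.
have a0 := norm_det_gt0 (uA m).
rewrite -(fineK g1_fin) -(fineK chi_fin) -!EFinM lee_fin.
have -> : 2 * (c^-1 * fine (Lpnorm 1 g) * (c^-1 * fine (Lpnorm 1 g))) * fine (energy chi) =
   K / 2 / `|\det (A m)|.
  rewrite -c2 /K; field.
  by move: a0; rewrite -c2 => /lt0r_neq0; rewrite expf_eq0.
rewrite ler_pdivrMr// -ler_pdivrMl//.
by near: m; move/cvgryPge : detA; exact.
Unshelve. all: by end_near. Qed.

End lowpass.

(** * Sums of nonnegative families *)

Section esum_complements.
Context {R : realType} {T : choiceType}.
Implicit Types (S : set T) (a : T -> \bar R).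

Lemma esumZl S a (c : R) : 0 < c -> (forall t, (0 <= a t)%E) ->
  (\esum_(t in S) (c%:E * a t) = c%:E * \esum_(t in S) a t)%E.
Proof.
move=> c0 a0; rewrite /esum -ereal_sup_pZl//; congr ereal_sup.
apply/seteqP; split=> [_ [X SX <-]|_ [_ [X SX <-] <-]].
  by exists (\sum_(t \in X) a t)%E; [exists X|rewrite ge0_mule_fsumr].
by exists X => //; rewrite ge0_mule_fsumr.
Qed.

Lemma le_esum_set S S' a : (forall t, (0 <= a t)%E) -> S `<=` S' ->
  (\esum_(t in S) a t <= \esum_(t in S') a t)%E.
Proof.
move=> a0 SS'; apply: ge_ereal_sup => _ [X [finX XS] <-].
by apply: esum_ge; exists X => //; split => //; exact: subset_trans XS SS'.
Qed.

(** An increasing union is directed. *)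
Lemma finite_subset_bigcup (S : nat -> set T) X : (forall m, S m `<=` S m.+1) ->
  finite_set X -> X `<=` \bigcup_m S m -> exists m, X `<=` S m.
Proof.
move=> Sincl /finite_seqP[s ->] FS.
have incl i j : (i <= j)%N -> S i `<=` S j.
  by move=> /subnK <-; elim: (j - i)%N => // k IH; exact: subset_trans IH (Sincl _).
have /choice[n Hn] : forall t, exists m, t \in s -> S m t.
  move=> t; have [tF|_] := boolP (t \in s); last by exists 0%N.
  by have [m _ Sm] := FS t tF; exists m.
exists (\max_(t <- s) n t)%N => t tF; apply: incl (Hn t tF).
exact: leq_bigmax_seq.
Qed.

Lemma cvg_esum_bigcup (S : nat -> set T) a : (forall t, (0 <= a t)%E) ->
  (forall m, S m `<=` S m.+1) ->
  \esum_(t in S m) a t @[m --> \oo] --> \esum_(t in \bigcup_m S m) a t.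
Proof.
move=> a0 Sincl; have -> : (\esum_(t in \bigcup_m S m) a t =
    ereal_sup (range (fun m => \esum_(t in S m) a t)))%E.
  apply/eqP; rewrite eq_le; apply/andP; split; last first.
    by apply: ge_ereal_sup => _ [m _ <-]; apply: le_esum_set => //; exact: bigcup_sup.
  apply: ge_ereal_sup => _ [X [finX XS] <-].
  have [m XSm] := finite_subset_bigcup Sincl finX XS.
  apply: (@le_trans _ _ (\esum_(t in S m) a t)%E); first by apply: esum_ge; exists X.
  by apply: ereal_sup_ubound; exists m.
by apply: ereal_nondecreasing_cvgn; apply/nondecreasing_seqP => m; exact: le_esum_set.
Qed.

End esum_complements.

(** * Functions and their classes in L^2 *)

Section L2_classes.
Context {R : realType} {d : nat}.
Implicit Types (f g h : 'cV[R]_d -> R[i]) (u v : L2 R d) (A : 'M[R]_d).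
Local Notation mu := (@lebesgue_cV R d).

Definition L2_class f : L2 R d := L2_of_fun (insubd 0 f).

Lemma L2_classE f : inL2 f -> L2_class f = f %[ae mu].
Proof.
move=> hf; have := L2_of_funK (insubd 0 f); rewrite /L2_class.
by rewrite insubdK//; exact/inL2P.
Qed.

Lemma L2_ae_inj u v : u = v %[ae mu] -> u = v.
Proof. by move=> uv; rewrite -(reprK u) -(reprK v); apply/L2_of_funP. Qed.

Lemma L2_inL2 u : inL2 u.
Proof. by apply/inL2P/asboolP; split; [exact: L2_cmeasurable|exact: L2_Lpnorm]. Qed.

Lemma L2_normE u : (`|u| ^+ 2)%:E = energy u.
Proof. by rewrite EFin_expe EFin_L2norm energyE. Qed.

Lemma energy_class f : inL2 f -> energy (L2_class f) = energy f.
Proof.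
by move=> hf; apply: energy_ae; [exact: (L2_inL2 _).1|exact: hf.1|exact: L2_classE].
Qed.

Lemma convolution_class f g : inL2 f -> cmeasurable g ->
  convolution (L2_class f) g = convolution f g.
Proof.
move=> hf mg; apply: eq_convolution_ae => //.
- exact: (L2_inL2 _).1.
- exact: hf.1.
- exact: L2_classE.
- exact: nearW.
Qed.

Lemma convolution_classr f g : cmeasurable f -> inL2 g ->
  convolution f (L2_class g) = convolution f g.
Proof.
move=> mf hg; apply: eq_convolution_ae => //.
- exact: (L2_inL2 _).1.
- exact: hg.1.
- exact: nearW.
- exact: L2_classE.
Qed.

Lemma energyD_ae u v : energy (u + v : L2 R d) = energy ((u : 'cV[R]_d -> R[i]) + (v : 'cV[R]_d -> R[i]))%R.
Proof.
apply: energy_ae; first exact: (L2_inL2 _).1.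
  by apply: cmeasurableD; exact: (L2_inL2 _).1.
exact: L2D.
Qed.

Lemma L2B u v : (u - v : L2 R d) = ((u : 'cV[R]_d -> R[i]) - (v : 'cV[R]_d -> R[i]))%R %[ae mu].
Proof.
by apply: filterS2 (L2D u (- v)) (L2N v) => x uv vN xT; rewrite uv// vN.
Qed.

Lemma energyB_ae u v : energy (u - v : L2 R d) = energy ((u : 'cV[R]_d -> R[i]) - (v : 'cV[R]_d -> R[i]))%R.
Proof.
apply: energy_ae; first exact: (L2_inL2 _).1.
  by apply: cmeasurableB; exact: (L2_inL2 _).1.
exact: L2B.
Qed.

Definition dilate_class p A u : L2 R d := L2_class (dilate p A u).

Lemma dilate_classE p A u : A \in unitmx -> dilate_class p A u = dilate p A u %[ae mu].
Proof. by move=> uA; apply: L2_classE; apply: inL2_dilate => //; exact: L2_inL2. Qed.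

(** For invertible A the filters dilated by A are the image of Psi under an
    injective map of L^2, which makes sums over them reindexable. *)
Lemma dilate_set_image p A (Psi : set (L2 R d)) : A \in unitmx ->
  dilate_set p A Psi = dilate_class p A @` Psi.
Proof.
move=> uA; apply/seteqP; split=> [phi [psi Ppsi phiE]|_ [psi Ppsi <-]].
  exists psi => //; apply: L2_ae_inj.
  by apply: filterS2 phiE (@dilate_classE p A psi uA) => x -> // ->.
by exists psi => //; exact: dilate_classE.
Qed.

Lemma dilate_class_inj p A : A \in unitmx -> injective (dilate_class p A).
Proof.
move=> uA u v uv; have a0 := norm_det_gt0 uA.
have uAi : invmx A \in unitmx by rewrite unitmx_inv.
have DD : {ae mu, forall x, dilate p A u x = dilate p A v x}.
  apply: filterS2 (@dilate_classE p A u uA) (@dilate_classE p A v uA) => x ux vx.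
  by rewrite -ux// -vx// uv.
apply: L2_ae_inj.
apply: filterS (has_jacobian_ae (norm_det_gt0 uAi) (has_jacobian_mulmx uAi) DD) => x.
rewrite /dilate mulKVmx// => /mulfI H _; apply: H.
by rewrite eq_complex negb_and /= gt_eqF// powR_gt0.
Qed.

End L2_classes.

(** * Cascades of convolutions and moduli *)

Section cascades.
Context {R : realType} {d : nat}.
Implicit Types (f g h : 'cV[R]_d -> R[i]) (Psi : set (L2 R d)) (A : 'M[R]_d).

(** An output a is read off at each of the first N layers, an output b at the
    last one. With a = 0 and b = energy this is the energy remainder; with a the
    low-pass energy and b = 0 it is the energy lost in the first N layers. Both
    are Lipschitz for the same reason, whence the common definition. *)
Fixpoint cascade Psi (a b : ('cV[R]_d -> R[i]) -> \bar R) (N : nat) f : \bar R :=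
  if N is N'.+1 then
    (a f + \esum_(psi in Psi) cascade Psi a b N' (modulus (convolution f (psi : L2 R d))))%E
  else b f.

(** With a = 0, the upper frame inequality; a leaves room for what is read off
    at each layer. *)
Definition bessel Psi (a : ('cV[R]_d -> R[i]) -> \bar R) := forall f, inL2 f ->
  (a f + \esum_(psi in Psi) energy (convolution f (psi : L2 R d)) <= energy f)%E.

(** Letting t vary, for a nonnegative and q the energy: the square root of a is
    1-Lipschitz for the L^2 norm. *)
Definition weighted_lipschitz (a q : ('cV[R]_d -> R[i]) -> \bar R) :=
  forall (t : R) f g, 0 < t -> inL2 f -> inL2 g ->
  (a f <= (1 + t)%:E * a g + (1 + t^-1)%:E * q (f - g)%R)%E.

Lemma cascade_ge0 Psi a b N f : (forall f, (0 <= a f)%E) -> (forall f, (0 <= b f)%E) ->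
  (0 <= cascade Psi a b N f)%E.
Proof.
move=> a0 b0; elim: N f => //= N IH f.
by rewrite adde_ge0// esum_ge0.
Qed.

Lemma bessel_convolution_le Psi a f (psi : L2 R d) : (forall f, (0 <= a f)%E) ->
  bessel Psi a -> Psi psi -> inL2 f -> (energy (convolution f psi) <= energy f)%E.
Proof.
move=> a0 H Ppsi hf; apply: le_trans (H f hf); rewrite -[leLHS]add0e.
apply: leeD => //; apply: esum_ge; exists [set psi]; last by rewrite fsbig_set1.
by split; [exact: finite_set1|move=> _ ->].
Qed.

Lemma bessel_inL2 Psi a f (psi : L2 R d) : (forall f, (0 <= a f)%E) ->
  bessel Psi a -> Psi psi -> inL2 f -> inL2 (convolution f psi).
Proof.
move=> a0 H Ppsi hf; split.
  by apply: cmeasurable_convolution; [exact: hf.1|exact: (L2_inL2 psi).1].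
by apply: le_lt_trans (bessel_convolution_le a0 H Ppsi hf) hf.2.
Qed.

(** In each layer the convolutions are linear and the modulus does not increase
    distances, and the Bessel inequality bounds what the difference f - g
    distributes over the outputs and over the next layer. *)
Lemma cascade_weighted_lipschitz Psi a b N :
  (forall f, (0 <= a f)%E) -> (forall f, (0 <= b f)%E) ->
  bessel Psi a -> weighted_lipschitz a a -> weighted_lipschitz b energy ->
  weighted_lipschitz (cascade Psi a b N) energy.
Proof.
move=> a0 b0 H Ha Hb; elim: N => [//|N IH] t f g t0 hf hg /=.
have t1 : 0 < 1 + t by rewrite addr_gt0.
have t2 : 0 < 1 + t^-1 by rewrite addr_gt0// invr_gt0.
have c0 f' : (0 <= cascade Psi a b N f')%E by exact: cascade_ge0.
have step : (a f + \esum_(psi in Psi) cascade Psi a b N (modulus (convolution f (psi : L2 R d))) <=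
    ((1 + t)%:E * a g + (1 + t^-1)%:E * a (f - g)%R) +
    \esum_(psi in Psi) ((1 + t)%:E * cascade Psi a b N (modulus (convolution g (psi : L2 R d))) +
       (1 + t^-1)%:E * energy (convolution (f - g)%R (psi : L2 R d))))%E.
  apply: leeD; first exact: Ha.
  apply: le_esum => psi Ppsi.
  have hfp := bessel_inL2 a0 H Ppsi hf; have hgp := bessel_inL2 a0 H Ppsi hg.
  apply: le_trans (IH t _ _ t0 (inL2_modulus hfp) (inL2_modulus hgp)) _.
  apply: leeD => //; apply: lee_wpmul2l; first by rewrite lee_fin ltW.
  apply: le_trans (energy_modulusB hfp.1 hgp.1) _.
  by rewrite convolutionB//; exact: L2_inL2.
apply: (le_trans step); rewrite esumD; last 2 first.
- by move=> psi _; rewrite mule_ge0// lee_fin ltW.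
- by move=> psi _; rewrite mule_ge0 ?energy_ge0// lee_fin ltW.
rewrite !esumZl//; last by move=> psi; exact: energy_ge0.
rewrite addeACA -!ge0_muleDr ?esum_ge0//; last by move=> psi _; exact: energy_ge0.
apply: leeD => //; apply: lee_wpmul2l; first by rewrite lee_fin ltW.
by apply: H; exact: inL2B.
Qed.

(** In a tight frame no energy gets lost between one layer and the next. *)
Lemma cascadeD Psi a N f : (forall f, (0 <= a f)%E) ->
  (forall f, inL2 f ->
    (a f + \esum_(psi in Psi) energy (convolution f (psi : L2 R d)) = energy f)%E) ->
  inL2 f ->
  (cascade Psi a (fun=> 0%E) N f + cascade Psi (fun=> 0%E) energy N f = energy f)%E.
Proof.
move=> a0 H; have Hb : bessel Psi a by move=> g hg; rewrite H.
elim: N f => [|N IH] f hf /=; first by rewrite add0e.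
rewrite add0e -addeA -esumD; last 2 first.
- by move=> psi _; exact: cascade_ge0.
- by move=> psi _; apply: cascade_ge0 => // g; exact: energy_ge0.
rewrite -[RHS](H f hf); congr (_ + _)%E; apply: eq_esum => psi Ppsi.
by rewrite IH ?energy_modulus//; apply: inL2_modulus; exact: bessel_inL2 Ppsi hf.
Qed.

(** A path of length N+1 is its first filter followed by a path of length N. *)
Lemma energy_remainder_cascade Psi N f :
  energy_remainder N Psi f = cascade Psi (fun=> 0%E) energy N f.
Proof.
elim: N f => [|N IH] f.
  rewrite /energy_remainder (_ : [set p | _] = [set [tuple]]).
    by rewrite esum_set1; [exact: energyE|rewrite energyE; exact: energy_ge0].
  by apply/seteqP; split=> [p _|p _ []//]; rewrite /= [p]tuple0.
rewrite /= add0e; under eq_esum do rewrite -IH.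
rewrite /energy_remainder esum_esum; last by move=> *; rewrite energyE energy_ge0.
rewrite (reindex_esum (Psi `*`` (fun=> [set p : N.-tuple (L2 R d) | forall i, Psi (tnth p i)]))
  _ (fun q => cons_tuple q.1 q.2)).
  by apply: eq_esum => -[psi p] _.
split=> [[psi p] /= [Ppsi Pp] i|[psi p] [psi' p'] _ _ /= /(congr1 val) [-> pp']|p /= Pp].
- have [j ->|->] := unliftP ord0 i; last by rewrite tnth0.
  by rewrite tnthS; exact: Pp.
- by congr pair; exact: val_inj.
- case/tupleP: p Pp => psi p Pp; exists (psi, p); last exact: val_inj.
  split=> /= [|i]; first by have := Pp ord0; rewrite tnth0.
  by have := Pp (lift ord0 i); rewrite tnthS.
Qed.

End cascades.

(** * The energy remainder *)

Section remainder.
Context {R : realType} {d : nat}.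
Implicit Types (f g h : 'cV[R]_d -> R[i]) (Psi : set (L2 R d)) (A : 'M[R]_d).
Local Notation mu := (@lebesgue_cV R d).

(** For functions instead of classes, because the inputs of the later layers are
    functions. *)
Definition tight_frame (chi : 'cV[R]_d -> R[i]) Psi := forall f, inL2 f ->
  (energy (convolution f chi) +
   \esum_(psi in Psi) energy (convolution f (psi : L2 R d)) = energy f)%E.

Lemma energy_remainder_ge0 N Psi f : (0 <= energy_remainder N Psi f)%E.
Proof.
rewrite energy_remainder_cascade; apply: cascade_ge0 => // g; exact: energy_ge0.
Qed.

Lemma energy_remainderS N Psi f : energy_remainder N.+1 Psi f =
  (\esum_(psi in Psi) energy_remainder N Psi (modulus (convolution f (psi : L2 R d))))%E.
Proof.
rewrite energy_remainder_cascade /= add0e.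
by apply: eq_esum => psi _; rewrite energy_remainder_cascade.
Qed.

Lemma energy_remainder1 Psi f : energy_remainder 1 Psi f =
  (\esum_(psi in Psi) energy (convolution f (psi : L2 R d)))%E.
Proof.
rewrite energy_remainderS; apply: eq_esum => psi _.
by rewrite energy_remainder_cascade/= energy_modulus.
Qed.

Lemma energy_remainder_ae N Psi f g : cmeasurable f -> cmeasurable g ->
  f = g %[ae mu] -> energy_remainder N Psi f = energy_remainder N Psi g.
Proof.
move=> mf mg fg; case: N => [|N].
  by rewrite !energy_remainder_cascade /=; exact: energy_ae.
rewrite !energy_remainderS; apply: eq_esum => psi _; congr energy_remainder.
congr modulus; apply: eq_convolution_ae => //; try exact: (L2_inL2 psi).1.
exact: nearW.
Qed.

Lemma energy_remainder_class N Psi f : inL2 f ->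
  energy_remainder N Psi (L2_class f) = energy_remainder N Psi f.
Proof.
move=> hf; apply: energy_remainder_ae; [exact: (L2_inL2 _).1|exact: hf.1|].
exact: L2_classE.
Qed.

Lemma energy_remainder_leS N Psi f : bessel Psi (fun=> 0%E) -> inL2 f ->
  (energy_remainder N.+1 Psi f <= energy_remainder N Psi f)%E.
Proof.
move=> H; elim: N f => [|N IH] f hf.
  by rewrite energy_remainder1 energy_remainder_cascade/= -[leLHS]add0e; exact: H.
rewrite energy_remainderS [leRHS]energy_remainderS; apply: le_esum => psi Ppsi.
by apply: IH; apply: inL2_modulus; exact: (bessel_inL2 (a := fun=> 0%E)) Ppsi hf.
Qed.

Lemma energy_remainder_le M N Psi f : bessel Psi (fun=> 0%E) -> inL2 f -> (M <= N)%N ->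
  (energy_remainder N Psi f <= energy_remainder M Psi f)%E.
Proof.
move=> H hf /subnK <-; elim: (N - M)%N => // k; apply: le_trans.
exact: energy_remainder_leS.
Qed.

Lemma energy_remainder_le_energy N Psi f : bessel Psi (fun=> 0%E) -> inL2 f ->
  (energy_remainder N Psi f <= energy f)%E.
Proof.
move=> H hf; apply: le_trans (energy_remainder_le H hf (leq0n N)) _.
by rewrite energy_remainder_cascade.
Qed.

Lemma energy_remainder_frame N Psi f :
  (forall g, inL2 g -> (\esum_(psi in Psi) energy (convolution g (psi : L2 R d)) = energy g)%E) ->
  inL2 f -> energy_remainder N Psi f = energy f.
Proof.
move=> H hf; rewrite energy_remainder_cascade.
have := @cascadeD R d Psi (fun=> 0%E) N f (fun=> lexx _).
have -> : cascade Psi (fun=> 0%E) (fun=> 0%E) N f = 0%E.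
  elim: N f {hf} => //= N IH f; rewrite esum1 ?adde0// => psi _; exact: IH.
by rewrite add0e; apply => // g hg; rewrite add0e H.
Qed.

(** A dilation can be moved past each convolution, at the expense of dilating
    the filter, and commutes with the modulus. *)
Lemma energy_remainder_dilate N Psi A f : bessel Psi (fun=> 0%E) -> A \in unitmx ->
  inL2 f -> energy_remainder N Psi (dilate 2 A f) =
          energy_remainder N (dilate_set 1 (invmx A) Psi) f.
Proof.
move=> H uA; have uAi : invmx A \in unitmx by rewrite unitmx_inv.
elim: N f => [|N IH] f hf.
  by rewrite !energy_remainder_cascade/= energy_dilate2//; exact: hf.1.
rewrite !energy_remainderS {1}(dilate_set_image 1 Psi uAi).
rewrite esum_image; last by move=> u v _ _; exact: (dilate_class_inj uAi).
apply: eq_esum => psi Ppsi; have hpsi := L2_inL2 psi.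
have hDf := inL2_dilate 2 uA hf.
have E := convolution_dilate uA hf hpsi.
have E' : convolution f (dilate_class 1 (invmx A) psi) =
    convolution f (dilate 1 (invmx A) (psi : L2 R d)).
  exact: convolution_classr hf.1 (inL2_dilate 1 uAi hpsi).
rewrite [X in _ = energy_remainder _ _ (modulus X)]E' E modulus_dilate.
apply: IH; apply: inL2_modulus.
have mc : cmeasurable (convolution f (dilate 1 (invmx A) (psi : L2 R d))).
  apply: cmeasurable_convolution; first exact: hf.1.
  by apply: cmeasurable_dilate; exact: hpsi.1.
split=> //; rewrite -(energy_dilate2 uA mc) -E.
exact: (bessel_inL2 (a := fun=> 0%E) _ H Ppsi hDf).2.
Qed.

Lemma tight_bessel chi Psi : tight_frame chi Psi ->
  bessel Psi (fun f => energy (convolution f chi)).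
Proof. by move=> H f hf; rewrite H. Qed.

Lemma tight_bessel0 chi Psi : tight_frame chi Psi -> bessel Psi (fun=> 0%E).
Proof.
by move=> H f hf; rewrite -(H f hf); apply: leeD => //; exact: energy_ge0.
Qed.

Lemma tight_lowpass_le chi Psi f : tight_frame chi Psi -> inL2 f ->
  (energy (convolution f chi) <= energy f)%E.
Proof.
move=> H hf; rewrite -(H f hf) leeDl// esum_ge0// => psi _; exact: energy_ge0.
Qed.

End remainder.

(** * The frames obtained by dilation *)

Section dilated_frames.
Context {R : realType} {d : nat}.
Variables (chi : 'cV[R]_d -> R[i]) (Psi : set (L2 R d)) (A : nat -> 'M[R]_d).
Hypotheses (chi_inL2 : inL2 chi) (tight : tight_frame chi Psi)
  (uA : forall m, A m \in unitmx) (detA : `|\det (A m)| @[m --> \oo] --> +oo)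
  (Psi_incl : forall m,
      dilate_set 1 (invmx (A m)) Psi `<=` dilate_set 1 (invmx (A m.+1)) Psi).
Implicit Types (f g h : 'cV[R]_d -> R[i]).

Let Psi_oo := \bigcup_m dilate_set 1 (invmx (A m)) Psi.

Lemma lowpass_cvg0 f : inL2 f ->
  energy (convolution (dilate 2 (A m) f) chi) @[m --> \oo] --> 0%E.
Proof.
move=> hf; apply: (lowpass_dilate_cvg0 chi_inL2 _ uA detA hf) => g hg.
exact: tight_lowpass_le tight hg.
Qed.

(** By dilation, the filters of index m miss exactly the low-pass energy of the
    dilated function, which tends to 0. *)
Lemma limit_frame f : inL2 f ->
  (\esum_(psi in Psi_oo) energy (convolution f (psi : L2 R d)) = energy f)%E.
Proof.
move=> hf.
have lim1 := cvg_esum_bigcup (a := fun psi : L2 R d => energy (convolution f psi))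
  (fun psi => energy_ge0 _) Psi_incl.
have E m : (\esum_(psi in dilate_set 1 (invmx (A m)) Psi) energy (convolution f (psi : L2 R d)) =
    energy f - energy (convolution (dilate 2 (A m) f) chi))%E.
  rewrite -energy_remainder1 -energy_remainder_dilate//; last exact: tight_bessel0 tight.
  have hD := inL2_dilate 2 (uA m) hf.
  have -> : energy f = energy (dilate 2 (A m) f) by rewrite energy_dilate2//; exact: hf.1.
  rewrite energy_remainder1 -(tight hD) [X in _ = (X - _)%E]addeC addeK//.
  rewrite ge0_fin_numE ?energy_ge0//.
  exact: le_lt_trans (tight_lowpass_le tight hD) hD.2.
have lim2 : \esum_(psi in dilate_set 1 (invmx (A m)) Psi)
    energy (convolution f (psi : L2 R d)) @[m --> \oo] --> (energy f - 0)%E.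
  rewrite (_ : (fun m => _) = fun m =>
      (energy f - energy (convolution (dilate 2 (A m) f) chi))%E); last exact/funext.
  by apply: cvgeB; [rewrite fin_num_adde_defl|exact: cvg_cst|exact: lowpass_cvg0].
by rewrite sube0 in lim2; exact: (cvg_unique _ lim1 lim2).
Qed.

(** The paths in Psi_m increase to the paths in the limit frame, and in the
    latter no energy is ever lost. *)
Lemma cvg_energy_remainder_dilate k f : inL2 f ->
  energy_remainder k Psi (dilate 2 (A m) f) @[m --> \oo] --> energy f.
Proof.
move=> hf; rewrite (_ : (fun m => _) = fun m =>
    energy_remainder k (dilate_set 1 (invmx (A m)) Psi) f); last first.
  by apply/funext => m; rewrite energy_remainder_dilate//; exact: tight_bessel0 tight.
rewrite -(@energy_remainder_frame R d k Psi_oo f)//; last by move=> g; exact: limit_frame.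
rewrite {2}/energy_remainder (_ : [set p : k.-tuple (L2 R d) | _] =
   \bigcup_m [set p | forall i, dilate_set 1 (invmx (A m)) Psi (tnth p i)]).
  apply: cvg_esum_bigcup => [p|m p Pp i].
    by rewrite energyE energy_ge0.
  exact/Psi_incl/Pp.
apply/seteqP; split=> [p /= Pp|p [m _ Pp] i]; last by exists m.
have [m Hm] : exists m, [set` tval p] `<=` dilate_set 1 (invmx (A m)) Psi.
  apply: finite_subset_bigcup Psi_incl _ _; first exact: finite_seq.
  by move=> psi /= /tnthP[i ->]; exact: Pp.
by exists m => // i; apply: Hm => /=; exact: mem_tnth.
Qed.

(** The energy of the scattering coefficients of order less than N. *)
Definition absorbed N f := cascade Psi (fun g => energy (convolution g chi)) (fun=> 0%E) N f.

Lemma absorbed_ge0 N f : (0 <= absorbed N f)%E.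
Proof. by apply: cascade_ge0 => // g; exact: energy_ge0. Qed.

Lemma absorbedD N f : inL2 f -> (absorbed N f + energy_remainder N Psi f = energy f)%E.
Proof.
move=> hf; rewrite energy_remainder_cascade; apply: cascadeD => // g.
exact: energy_ge0.
Qed.

Lemma absorbed_weighted N : weighted_lipschitz (absorbed N) energy.
Proof.
apply: cascade_weighted_lipschitz => //.
- by move=> g; exact: energy_ge0.
- exact: tight_bessel.
- move=> t f g t0 hf hg; rewrite convolutionB//.
  have mc f' : inL2 f' -> cmeasurable (convolution f' chi).
    by move=> hf'; apply: cmeasurable_convolution; [exact: hf'.1|exact: chi_inL2.1].
  have mB : cmeasurable (convolution f chi - convolution g chi).
    by apply: cmeasurableB; exact: mc.
  have := energyD_weighted t0 (mc _ hg) mB.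
  by rewrite addrC subrK.
- by move=> t f g t0 hf hg; rewrite mule0 add0e mule_ge0 ?energy_ge0// lee_fin addr_ge0// invr_ge0 ltW.
Qed.

Lemma remainder_weighted N : weighted_lipschitz (energy_remainder N Psi) energy.
Proof.
move=> t f g t0 hf hg; rewrite !energy_remainder_cascade.
apply: cascade_weighted_lipschitz => //.
- by move=> h; exact: energy_ge0.
- exact: tight_bessel0 tight.
- by move=> s f' g' s0 _ _; rewrite !mule0 adde0.
- move=> s f' g' s0 hf' hg'; have := energyD_weighted s0 hg'.1 (inL2B hf' hg').1.
  by rewrite addrC subrK.
Qed.

(** The remainder already accounts for all the energy in the limit. *)
Lemma absorbed_dilate_cvg0 N f : inL2 f ->
  absorbed N (dilate 2 (A m) f) @[m --> \oo] --> 0%E.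
Proof.
move=> hf; have E m : absorbed N (dilate 2 (A m) f) =
    (energy f - energy_remainder N Psi (dilate 2 (A m) f))%E.
  have hD := inL2_dilate 2 (uA m) hf.
  have -> : energy f = energy (dilate 2 (A m) f) by rewrite energy_dilate2//; exact: hf.1.
  rewrite -(absorbedD N hD) addeK// ge0_fin_numE ?energy_remainder_ge0//.
  exact: le_lt_trans (energy_remainder_le_energy N (tight_bessel0 tight) hD) hD.2.
have f_fin : energy f \is a fin_num by rewrite ge0_fin_numE ?energy_ge0//; exact: hf.2.
rewrite (_ : (fun m => _) = fun m =>
    (energy f - energy_remainder N Psi (dilate 2 (A m) f))%E); last exact/funext.
rewrite -(subee f_fin); apply: cvgeB; [by rewrite fin_num_adde_defr|exact: cvg_cst|].
exact: cvg_energy_remainder_dilate.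
Qed.

End dilated_frames.

(** * Convergence of geometrically small series in L^2 *)

Section geometric_series.
Context {R : realType} {d : nat}.
Implicit Types (f g h : 'cV[R]_d -> R[i]).
Local Notation normc := Normc.normc.
Local Notation Re := complex.Re.
Local Notation Im := complex.Im.
Local Notation mu := (@lebesgue_cV R d).

Lemma inL2_series (v : nat -> 'cV[R]_d -> R[i]) n : (forall j, inL2 (v j)) -> inL2 (series v n).
Proof.
move=> hv; elim: n => [|n IH]; last by rewrite seriesSr; exact: inL2D.
rewrite /series /= big_geq//; split; first exact: cmeasurable0.
rewrite /energy integral0_eq// => x _.
by rewrite [X in normc X](_ : _ = 0)// Normc.normc0 expr0n.
Qed.

Lemma Re_series (v : nat -> 'cV[R]_d -> R[i]) n x :
  Re (series v n x) = series (fun j => Re (v j x)) n.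
Proof.
elim: n => [|n IH]; first by rewrite /series /= !big_geq.
by rewrite !seriesSr fctE Re_add IH.
Qed.

Lemma Im_series (v : nat -> 'cV[R]_d -> R[i]) n x :
  Im (series v n x) = series (fun j => Im (v j x)) n.
Proof.
elim: n => [|n IH]; first by rewrite /series /= !big_geq.
by rewrite !seriesSr fctE Im_add IH.
Qed.

(** Splitting off the first term, with weight t = 1/2. *)
Lemma energy_series_le (v : nat -> 'cV[R]_d -> R[i]) (c : R) n k :
  (forall j, inL2 (v j)) -> (forall j, (energy (v j) <= (c * 9 ^- j)%:E)%E) ->
  (energy (series v (n + k)%N - series v n)%R <= (9 / 4 * c * 9 ^- n)%:E)%E.
Proof.
move=> hv vc; elim: k n => [|k IH] n.
  rewrite addn0 subrr /energy integral0_eq => [|x _]; last first.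
    by rewrite [X in normc X](_ : _ = 0)// Normc.normc0 expr0n.
  have := le_trans (energy_ge0 _) (vc n).
  by rewrite !lee_fin -mulrA => ?; rewrite mulr_ge0.
have -> : series v (n + k.+1)%N - series v n =
    v n + (series v (n.+1 + k)%N - series v n.+1).
  by rewrite addnS addSn [series v n.+1]seriesSr opprD [- _ - v n]addrC addrCA addNKr.
(* The constant 9/4 reproduces itself: 3/2 + 3 (9/4) / 9 = 9/4. *)
have t0 : 0 < 2^-1 :> R by rewrite invr_gt0.
have hs : inL2 (series v (n.+1 + k)%N - series v n.+1) by apply: inL2B; exact: inL2_series.
apply: le_trans (energyD_weighted t0 (hv n).1 hs.1) _.
apply: (@le_trans _ _ ((1 + 2^-1)%:E * (c * 9 ^- n)%:E +
    (1 + 2^-1^-1)%:E * (9 / 4 * c * 9 ^- n.+1)%:E)%E).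
  by apply: leeD; apply: lee_wpmul2l.
rewrite -!EFinM -EFinD lee_fin exprS le_eqVlt; apply/orP; left; apply/eqP.
by field; rewrite expf_neq0.
Qed.

Lemma geometric_sum_le (c : R) n : 0 <= c -> series (fun j => c * 3 ^- j) n <= 2 * c.
Proof.
move=> c0; suff : series (fun j => c * 3 ^- j) n <= (3 / 2) * c * (1 - 3 ^- n).
  move=> /le_trans; apply; have : 0 <= c * 3 ^- n by rewrite mulr_ge0// invr_ge0 exprn_ge0.
  lra.
elim: n => [|n IH]; first by rewrite /series /= big_geq// expr0 invr1 subrr mulr0.
rewrite seriesSr; apply: le_trans (lerD IH (lexx _)) _.
rewrite le_eqVlt; apply/orP; left; apply/eqP; rewrite exprS; field.
by rewrite expf_neq0.
Qed.

(** The integral of the weighted sum is at most the sum of c 3^-j. *)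
Lemma ae_weighted_sum_fin (v : nat -> 'cV[R]_d -> R[i]) (c : R) :
  (forall j, inL2 (v j)) -> (forall j, (energy (v j) <= (c * 9 ^- j)%:E)%E) ->
  exists E : set 'cV[R]_d, [/\ measurable E, {ae mu, forall x, E x} &
    forall x, E x -> exists M : R, forall n,
      series (fun j => 3 ^+ j * normc (v j x) ^+ 2) n <= M].
Proof.
move=> hv vc.
pose F j x : \bar R := (3 ^+ j * normc (v j x) ^+ 2)%:E.
have F0 j x : (0 <= F j x)%E by rewrite lee_fin; apply: mulr_ge0; [exact: exprn_ge0|exact: sqr_ge0].
have mF j : measurable_fun setT (F j).
  apply/measurable_EFinP; apply: measurable_funM => //.
  by apply: measurable_funX; exact: measurable_normc (hv j).1.
pose G x := (\sum_(0 <= j <oo) F j x)%E.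
have mG : measurable_fun setT G.
  have := @ge0_emeasurable_sum _ _ R setT F predT (fun k x _ _ => F0 k x) (fun k _ => mF k).
  exact.
have G0 x : (0 <= G x)%E by apply: nneseries_ge0.
have intF j : (\int[mu]_x F j x <= (c * 3 ^- j)%:E)%E.
  have -> : (\int[mu]_x F j x = (3 ^+ j)%:E * energy (v j))%E.
    rewrite /F; under eq_integral do rewrite EFinM.
    rewrite ge0_integralZl//; last 2 first.
    - exact: measurable_normc_sqr (hv j).1.
    - by move=> x _; rewrite lee_fin sqr_ge0.
  apply: (@le_trans _ _ ((3 ^+ j)%:E * (c * 9 ^- j)%:E)%E).
    by apply: lee_wpmul2l => //; rewrite lee_fin exprn_ge0.
  rewrite -EFinM lee_fin (_ : 9 = 3 * 3 :> R); last by ring.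
  rewrite exprMn le_eqVlt; apply/orP; left; apply/eqP; field.
  by rewrite expf_neq0.
have c0 : 0 <= c.
  by have := le_trans (energy_ge0 _) (vc 0%N); rewrite lee_fin expr0 invr1 mulr1.
have intG : (\int[mu]_x G x <= (2 * c)%:E)%E.
  rewrite /G integral_nneseries//.
  apply: lime_le; first by apply: is_cvg_nneseries => j _ _; exact: integral_ge0.
  apply: nearW => n; apply: le_trans (_ : (series (fun j => c * 3 ^- j) n)%:E <= _)%E.
    by rewrite /series /= -sumEFin; apply: lee_sum => j _.
  by rewrite lee_fin geometric_sum_le.
have iG : mu.-integrable setT G.
  apply/integrableP; split=> //.
  under eq_integral do rewrite gee0_abs//.
  by apply: le_lt_trans intG _; rewrite ltry.
exists (setT `&` [set x | (G x < +oo)%E]); split.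
- by apply: measurable_lte => //; exact: measurable_cst.
- apply: filterS (integrable_ae measurableT iG) => x Gx; split => //=.
  by rewrite -ge0_fin_numE//; exact: Gx.
- move=> x [_ /= Gx]; exists (fine (G x)) => n.
  rewrite -lee_fin fineK ?ge0_fin_numE// /series/= -sumEFin.
  exact: (nneseries_lim_ge n (fun j _ _ => F0 j x)).
Qed.

(** By w <= 3^-j + 3^j w^2 the series converges absolutely. *)
Lemma cvg_series_of_sqr_bound (u w : nat -> R) (M : R) :
  (forall j, `|u j| <= w j) ->
  (forall n, series (fun j => 3 ^+ j * w j ^+ 2) n <= M) -> cvgn (series u).
Proof.
move=> uw wM; apply: normed_cvg.
apply: nondecreasing_is_cvgn.
  apply/nondecreasing_seqP => n /=; rewrite /series /= big_nat_recr//= lerDl//.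
exists (2 + M) => _ [n _ <-].
apply: (@le_trans _ _ (series (fun j => 1 * 3 ^- j) n + series (fun j => 3 ^+ j * w j ^+ 2) n)).
  rewrite /series /= -big_split/=; apply: ler_sum => j _.
  apply: le_trans (uw j) _; rewrite mul1r.
  have p0 : 0 < 3 ^+ j :> R by rewrite exprn_gt0.
  have w0 : 0 <= w j := le_trans (normr_ge0 _) (uw j).
  rewrite -subr_ge0.
  have -> : 3 ^- j + 3 ^+ j * w j ^+ 2 - w j =
     ((1 - 3 ^+ j * w j) ^+ 2 + 3 ^+ j * w j) / 3 ^+ j by field; exact: lt0r_neq0.
  by rewrite divr_ge0 ?addr_ge0 ?sqr_ge0 ?mulr_ge0// ltW.
by apply: lerD => //; apply: le_trans (geometric_sum_le n ler01) _; rewrite mulr1.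
Qed.

(** The case of the Riesz-Fischer theorem in which the norms of the terms
    decrease like 3^-j. The series converges almost everywhere, and Fatou's
    lemma transfers the bounds on the partial sums to the limit. *)
Lemma geometric_series_L2 (v : nat -> 'cV[R]_d -> R[i]) (c : R) :
  (forall j, inL2 (v j)) -> (forall j, (energy (v j) <= (c * 9 ^- j)%:E)%E) ->
  exists w, inL2 w /\
    forall n, (energy (w - series v n)%R <= (9 / 4 * c * 9 ^- n)%:E)%E.
Proof.
move=> hv vc; have [E [mE aeE HE]] := ae_weighted_sum_fin hv vc.
pose ind x : R[i] := ((\1_E x)%:C)%C.
have mind : cmeasurable ind by split; [exact: measurable_indic|exact: measurable_cst].
(* Replacing the terms by 0 off E makes the series converge everywhere, so that
   its sum is measurable, and changes nothing almost everywhere. *)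
pose v' j x := ind x * v j x.
have v'v j : v' j = v j %[ae mu].
  by apply: filterS aeE => x Ex _; rewrite /v' /ind indicE mem_set// mul1r.
have mv' j : cmeasurable (v' j) by apply: cmeasurableM => //; exact: (hv j).1.
have ev' j : energy (v' j) = energy (v j) by apply: energy_ae => //; exact: (hv j).1.
have hv' j : inL2 (v' j) by split=> //; rewrite ev'; exact: (hv j).2.
have vc' j : (energy (v' j) <= (c * 9 ^- j)%:E)%E by rewrite ev'.
have bound x : exists M, forall n, series (fun j => 3 ^+ j * normc (v' j x) ^+ 2) n <= M.
  have [xE|xE] := pselect (E x).
    have [M HM] := HE x xE; exists M => n; apply: le_trans (HM n).
    by apply: ler_sum => j _; rewrite /v' /ind indicE mem_set// mul1r.
  exists 0 => n; rewrite /series /= big1// => j _.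
  by rewrite /v' /ind indicE memNset// mul0r Normc.normc0 expr0n mulr0.
have cRe x : cvgn (series (fun j => Re (v' j x))).
  by have [M HM] := bound x; apply: cvg_series_of_sqr_bound HM => j; exact: normc_Re.
have cIm x : cvgn (series (fun j => Im (v' j x))).
  by have [M HM] := bound x; apply: cvg_series_of_sqr_bound HM => j; exact: normc_Im.
pose w x := ((limn (series (fun j => Re (v' j x)))) +i*
             (limn (series (fun j => Im (v' j x)))))%C.
have mw : cmeasurable w.
  split.
    apply: (@measurable_fun_cvg _ _ _ _ (fun n x => Re (series v' n x))).
      by move=> n; exact: (inL2_series n hv').1.1.
    by move=> x _; under eq_fun do rewrite Re_series; exact: cRe.
  apply: (@measurable_fun_cvg _ _ _ _ (fun n x => Im (series v' n x))).
    by move=> n; exact: (inL2_series n hv').1.2.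
  by move=> x _; under eq_fun do rewrite Im_series; exact: cIm.
have mS n : cmeasurable (series v' n) := (inL2_series n hv').1.
have S'S n : series v' n = series v n %[ae mu].
  elim: n => [|n IH]; first by apply: nearW => x _; rewrite /series /= !big_geq.
  rewrite !seriesSr; apply: filterS2 IH (v'v n) => x Sx vx _.
  by rewrite !fctE Sx// vx.
have tail n : (energy (w - series v' n)%R <= (9 / 4 * c * 9 ^- n)%:E)%E.
  pose F k x := (normc ((series v' (n + k)%N - series v' n) x) ^+ 2)%:E.
  have FE x : (normc ((w - series v' n) x) ^+ 2)%:E = limn_einf (F ^~ x).
    suff /cvg_limn_einf_sup[-> _] : F k x @[k --> \oo] --> (normc ((w - series v' n) x) ^+ 2)%:E by [].
    apply: cvg_EFin; first exact: nearW.
    rewrite /F /=; under eq_cvg do rewrite /= normc_sqr !fctE Re_sub Im_sub Re_series Im_series.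
    rewrite normc_sqr !fctE Re_sub Im_sub Re_series Im_series.
    have shift (s : nat -> R) : cvgn s -> s (n + k)%N @[k --> \oo] --> limn s.
      move=> cs; rewrite (_ : (fun k => _) = [sequence s (k + n)%N]_k).
        by rewrite cvg_shiftn.
      by apply/funext => k; rewrite addnC.
    apply: cvgD; rewrite ?expr2; under eq_cvg do rewrite ?expr2.
      by apply: cvgM; (apply: cvgB; [exact: shift|exact: cvg_cst]).
    by apply: cvgM; (apply: cvgB; [exact: shift|exact: cvg_cst]).
  rewrite /energy; under eq_integral do rewrite FE.
  apply: le_trans (fatou mu measurableT _ _) _.
  - by move=> k; apply: measurable_normc_sqr; exact: cmeasurableB.
  - by move=> k x _; rewrite lee_fin sqr_ge0.
  apply: le_trans (limn_einf_sup _) _; rewrite limn_esup_lim.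
  apply: lime_le; first exact: is_cvg_esups.
  apply: nearW => m; apply: ge_ereal_sup => _ [k _ <-].
  exact: energy_series_le.
exists w; split.
  split=> //; apply: le_lt_trans (_ : _ <= (9 / 4 * c * 9 ^- 0)%:E)%E _; last exact: ltry.
  have -> : w = w - series v' 0 by rewrite /series /= big_geq// subr0.
  exact: tail.
move=> n; apply: le_trans (tail n); rewrite le_eqVlt; apply/orP; left; apply/eqP.
apply: energy_ae.
- by apply: cmeasurableB => //; exact: (inL2_series n hv).1.
- exact: cmeasurableB.
- by apply: filterS (S'S n) => x Sx _; rewrite !fctE Sx.
Qed.

End geometric_series.

(** * Gliding humps *)

Lemma null_seq_small {R : realType} (E : nat -> R) (e : R) :
  positive_nonincreasing_null E -> 0 < e ->
  exists n, forall N, (n <= N)%N -> E N <= e.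
Proof.
move=> [_ _ /cvgrPdist_le E0] e0; have [n _ Hn] := E0 _ e0; exists n => N nN.
by have := Hn N nN; rewrite sub0r normrN => /(le_trans (ler_norm _)).
Qed.

Lemma null_seq_small_after {R : realType} (E : nat -> R) (c e : R) n :
  positive_nonincreasing_null E -> 0 < c -> 0 < e ->
  exists2 N, (n < N)%N & c * E N <= e.
Proof.
move=> HE c0 e0; have [M HM] := null_seq_small HE (divr_gt0 e0 c0).
exists (maxn M n.+1); first exact: leq_maxr.
by have := HM _ (leq_maxl M n.+1); rewrite ler_pdivlMr// mulrC.
Qed.

Lemma sqrt_positive_nonincreasing_null {R : realType} (E : nat -> R) (c : R) : 0 < c ->
  positive_nonincreasing_null E ->
  positive_nonincreasing_null (fun n => c * Num.sqrt (E n)).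
Proof.
move=> c0 [Epos Ele E0]; split.
- by move=> N N0; rewrite mulr_gt0// sqrtr_gt0 Epos.
- by move=> M N MN; rewrite ler_pM2l// ler_wsqrtr// Ele.
- rewrite -(mulr0 c); apply: cvgMr; rewrite -[X in _ --> X]sqrtr0.
  by apply: (cvg_comp E Num.sqrt E0); exact: sqrt_continuous.
Qed.

Section gliding_hump.
Context {R : realType} {d : nat}.
Variables (chi : 'cV[R]_d -> R[i]) (Psi : set (L2 R d)) (A : nat -> 'M[R]_d).
Hypotheses (chi_inL2 : inL2 chi) (tight : tight_frame chi Psi)
  (uA : forall m, A m \in unitmx) (detA : `|\det (A m)| @[m --> \oo] --> +oo)
  (Psi_incl : forall m,
      dilate_set 1 (invmx (A m)) Psi `<=` dilate_set 1 (invmx (A m.+1)) Psi).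
Implicit Types (f g h u v : 'cV[R]_d -> R[i]).
Local Notation W N := (energy_remainder N Psi).

Lemma inL2_energy_real f : inL2 f -> exists2 r : R, 0 <= r & energy f = r%:E.
Proof.
move=> [_ foo]; have := energy_ge0 f; move: foo.
by case: (energy f) => [r| |]//= _ r0; exists r.
Qed.

Lemma energy0 : energy (0 : 'cV[R]_d -> R[i]) = 0%E.
Proof. by apply: integral0_eq => x _; rewrite Normc.normc0 expr0n. Qed.

Lemma dilateN p (B : 'M[R]_d) h : dilate p B (- h) = - dilate p B h.
Proof. by apply/funext => x; rewrite /dilate !fctE mulrN. Qed.

(** The function v is a dilation of h or of - h. By the Lipschitz property the
    low-pass filter takes from u + v little more than the energy of u, since it
    takes almost nothing from v alone; for one of the two signs, u + v has at
    least the energies of u and h together. *)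
Lemma hump u h (e : R) N : inL2 u -> inL2 h -> 0 < e ->
  exists v, [/\ inL2 v, energy v = energy h & (energy h <= W N (u + v)%R + e%:E)%E].
Proof.
move=> hu hh e0.
have [k k0 Ek] := inL2_energy_real hu; have [l l0 El] := inL2_energy_real hh.
(* With these choices t k <= e / 2 and (1 + 1/t) eta = e / 2. *)
pose t := e / (2 * (k + 1)).
have t0 : 0 < t by rewrite divr_gt0// mulr_gt0// ltr_wpDl.
pose eta := e / 2 / (1 + t^-1).
have eta0 : 0 < eta by rewrite !divr_gt0// addr_gt0// invr_gt0.
have small h' : inL2 h' -> \forall m \near \oo,
    (absorbed chi Psi N (dilate 2 (A m) h') <= eta%:E)%E.
  move=> hh'.
  have /cvge0P := absorbed_dilate_cvg0 chi_inL2 tight uA detA Psi_incl N hh'.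
  by apply => // m; exact: absorbed_ge0.
(* Both h and - h are needed since the sign of the hump is chosen after m. *)
have hNh := inL2N hh.
near \oo => m.
have ab1 : (absorbed chi Psi N (dilate 2 (A m) h) <= eta%:E)%E.
  by near: m; exact: small.
have ab2 : (absorbed chi Psi N (- dilate 2 (A m) h)%R <= eta%:E)%E.
  by rewrite -dilateN; near: m; exact: small.
set D := dilate 2 (A m) h in ab1 ab2.
have hD : inL2 D by exact: inL2_dilate.
have ED : energy D = energy h by rewrite /D energy_dilate2//; exact: hh.1.
have key v : inL2 v -> energy v = energy h -> (absorbed chi Psi N v <= eta%:E)%E ->
    (energy u + energy h <= energy (u + v)%R)%E ->
    exists v, [/\ inL2 v, energy v = energy h & (energy h <= W N (u + v)%R + e%:E)%E].
  move=> hv Ev av uv; exists v; split=> //.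
  have huv := inL2D hu hv.
  have [p p0 Ep] := inL2_energy_real huv.
  have ti : 0 < t^-1 by rewrite invr_gt0.
  have := absorbed_weighted chi_inL2 tight N ti huv hv.
  rewrite invrK addrK => le_ab.
  have {}le_ab : (absorbed chi Psi N (u + v)%R <= (e / 2 + (1 + t) * k)%:E)%E.
    apply: le_trans le_ab _; rewrite [leRHS]EFinD; apply: leeD; last by rewrite Ek EFinM.
    apply: (@le_trans _ _ ((1 + t^-1)%:E * eta%:E)%E).
      by apply: lee_wpmul2l => //; rewrite lee_fin addr_ge0// ltW.
    rewrite -EFinM lee_fin /eta mulrCA mulfV ?mulr1//.
    by rewrite gt_eqF// addr_gt0.
  move: uv; rewrite Ep Ek El -EFinD lee_fin => uv.
  have := absorbedD tight N huv; rewrite Ep.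
  have := absorbed_ge0 chi Psi N (u + v); have := energy_remainder_ge0 N Psi (u + v).
  move: le_ab; case: (absorbed _ _ _ _) => [a| |]//; case: (W N _) => [b| |]//.
  rewrite !lee_fin => le_ab b0 a0 [ab].
  have tk : t * k <= e / 2.
    rewrite /t -subr_ge0 (_ : e / 2 - _ = e / (2 * (k + 1))); last first.
      by field; rewrite gt_eqF// ltr_wpDl.
    by rewrite ltW.
  by lra.
have par := energy_parallelogram hu.1 hD.1.
have [uD|uD] := leP (energy u + energy h)%E (energy (u + D)%R).
  exact: (key D).
apply: (key (- D)) => //; [exact: inL2N|by rewrite energyN|].
move: par uD; rewrite ED Ek El.
have [p p0 ->] := inL2_energy_real (inL2D hu hD); have [q q0 ->] := inL2_energy_real (inL2B hu hD).
by rewrite -!EFinM -!EFinD => -[pq]; rewrite lte_fin lee_fin => pl; lra.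
Unshelve. all: by end_near. Qed.

(** Humps of energy 9^-j E_1 times that of g are added successively to g, the
    j-th one such that it is still present in the layer n_(j+1), after which E
    is below 9^-(j+1) E_1. Hence for n_j <= N < n_(j+1) the remainder is bounded
    from below thanks to the j-th hump. *)
Lemma slow_decay g (E : nat -> R) : inL2 g -> positive_nonincreasing_null E ->
  exists f, [/\ inL2 f, (energy (f - g)%R <= (9 / 4 * E 1%N)%:E * energy g)%E &
    forall N, (0 < N)%N -> ((E N / 8)%:E * energy g <= W N f)%E].
Proof.
move=> hg HE; have [Epos Ele E0] := HE; have [l l0 El] := inL2_energy_real hg.
have E1 := Epos 1%N isT.
have [l_eq0|lneq0] := eqVneq l 0.
  exists g; split=> //; first by rewrite subrr energy0 mule_ge0 ?energy_ge0// lee_fin mulr_ge0// ltW.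
  by move=> N _; rewrite El l_eq0 mule0; exact: energy_remainder_ge0.
have lpos : 0 < l by rewrite lt0r lneq0.
have /choice[n0 Hn0] : forall j, exists n, forall N, (n <= N)%N -> E N <= E 1%N * 9 ^- j.
  by move=> j; apply: null_seq_small HE _; rewrite divr_gt0 ?exprn_gt0.
(* Starting at 1 and exceeding every j, the thresholds n j leave no N >= 1 out. *)
pose n j := if j is 0%N then 1%N else maxn j (n0 j).
have Hn j N : (n j <= N)%N -> E N <= E 1%N * 9 ^- j.
  case: j => [|j]; first by rewrite expr0 invr1 mulr1 => N1; apply: Ele; rewrite N1.
  by rewrite /n geq_max => /andP[_]; exact: Hn0.
pose a j := E 1%N * 9 ^- j.
have a0 j : 0 < a j by rewrite divr_gt0 ?exprn_gt0.
have /choice[V HV] : forall p : nat * ('cV[R]_d -> R[i]), exists v, inL2 p.2 ->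
    [/\ inL2 v, energy v = (a p.1 * l)%:E &
     ((3 / 4 * (a p.1 * l))%:E <= W (n p.1.+1) (p.2 + v)%R)%E].
  move=> [j u] /=; have [hu|] := pselect (inL2 u); last by exists 0.
  pose h := fun x => ((Num.sqrt (a j))%:C)%C * g x.
  have hh : inL2 h by exact: inL2_scale.
  have Eh : energy h = (a j * l)%:E.
    by rewrite energy_scale ?sqr_sqrtr ?ltW//; [rewrite El EFinM|exact: hg.1].
  have e0 : 0 < a j * l / 4 by rewrite divr_gt0// mulr_gt0.
  have [v [hv Ev Hv]] := hump (n j.+1) hu hh e0.
  exists v => _; split=> //; first by rewrite Ev.
  move: Hv; rewrite Eh -leeBlDr// -EFinB; apply: le_trans.
  by rewrite lee_fin; lra.
(* The recursion carries the partial sums because each hump is chosen in terms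
   of the previous one. *)
pose F := fix F j := if j is j'.+1 then F j' + V (j', F j') else g.
have hF j : inL2 (F j).
  elim: j => //= j IH; apply: inL2D => //.
  by have [] := HV (j, F j) IH.
pose v j := V (j, F j).
have hv j : inL2 (v j) by have [] := HV (j, F j) (hF j).
have Ev j : energy (v j) = (a j * l)%:E by have [] := HV (j, F j) (hF j).
have FE j : F j = g + series v j.
  elim: j => [|j IH]; first by rewrite /series /= big_geq// addr0.
  by rewrite seriesSr addrA -IH.
have [w [hw Hw]] : exists w, inL2 w /\
    forall j, (energy (w - series v j)%R <= (9 / 4 * (E 1%N * l) * 9 ^- j)%:E)%E.
  apply: geometric_series_L2 => // j; rewrite Ev lee_fin /a.
  by rewrite mulrAC.
exists (g + w); split; first exact: inL2D.
  rewrite addrAC subrr add0r El -EFinM.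
  have := Hw 0%N; rewrite /series /= big_geq// subr0 expr0 invr1 mulr1.
  by rewrite mulrA.
move=> N N0.
have [k Nk kmin] : exists2 k, (N < n k)%N & forall j, (N < n j)%N -> (k <= j)%N.
  have ex : exists k, (N < n k)%N by exists N.+1; rewrite leq_max leqnn.
  by exists (ex_minn ex); case: ex_minnP.
case: k Nk kmin => [|k] Nk kmin; first by move: Nk; rewrite /n ltnS leqNgt N0.
have nkN : (n k <= N)%N by rewrite leqNgt; apply/negP => /kmin; rewrite ltnn.
have hf := inL2D hg hw.
apply: le_trans (energy_remainder_le (tight_bessel0 tight) hf (ltnW Nk)).
have [_ _ HW] := HV (k, F k) (hF k).
have := remainder_weighted tight (n k.+1) ltr01 (hF k.+1) hf.
have -> : F k.+1 - (g + w) = - (w - series v k.+1).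
  by rewrite FE opprD addrACA subrr add0r opprB.
rewrite energyN invr1 => Hlip.
(* With weight t = 1 and a = a k l, the hump gives 3/4 a <= 2 W + 2 (9/4) a /
   9, that is W >= a / 8. *)
have {Hlip} := le_trans (le_trans HW Hlip) (leeD (lexx _) (lee_wpmul2l _ (Hw k.+1))).
rewrite lee_fin => /(_ (addr_ge0 ler01 ler01)).
have := energy_remainder_ge0 (n k.+1) Psi (g + w).
rewrite El; case: (W _ _) => [b| |]//; last by move=> _ _; rewrite leey.
rewrite /= -!EFinM -EFinD !lee_fin => b0 Hb.
have := Hn k N nkN; have := a0 k; rewrite -/(a k) => ak Nak.
have Ek1 : E 1%N * l * 9 ^- k.+1 = a k * l / 9.
  by rewrite /a exprS; field; rewrite expf_neq0.
have : E N * l <= a k * l by rewrite ler_pM2r.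
by move: Hb; rewrite -(mulrA (9 / 4)) Ek1; lra.
Qed.

End gliding_hump.

(** * Consequences in L^2 *)

Section L2_consequences.
Context {R : realType} {d : nat}.
Implicit Types (f g h : L2 R d) (Psi : set (L2 R d)) (A : 'M[R]_d).

(** A multiple of the indicator function of the unit cube. *)
Lemma exists_energy (c : R) : 0 <= c ->
  exists2 f : 'cV[R]_d -> R[i], inL2 f & energy f = c%:E.
Proof.
move=> c0.
pose B := [set x : 'cV[R]_d | forall i : 'I_d, `[0, 1]%classic (x i ord0)].
have mB : measurable B.
  rewrite (_ : B = \bigcap_(i in [set: 'I_d])
      ((fun x : 'cV[R]_d => x i ord0) @^-1` `[0, 1]%classic)); last first.
    by apply/seteqP; split => x /= Bx i => [_|]; apply: Bx.
  apply: fin_bigcap_measurable => // i _; rewrite -[X in measurable X]setTI.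
  exact: measurable_coord.
have lB : lebesgue_cV d B = 1%E.
  rewrite (lebesgue_cV_box (A := fun=> `[0, 1]%classic))//.
  by rewrite big1// => i _; rewrite lebesgue_measure_itv/= lte_fin ltr01 -EFinB subr0.
pose f0 (x : 'cV[R]_d) : R[i] := ((\1_B x)%:C)%C.
have mf0 : cmeasurable f0 by split; [exact: measurable_indic|exact: measurable_cst].
have ef0 : energy f0 = 1%E.
  rewrite -lB -[B]setIT -integral_indic//; apply: eq_integral => x _.
  rewrite normc_real real_normK ?num_real// indicE.
  by case: (x \in B); rewrite ?expr1n ?expr0n.
have hf0 : inL2 f0 by split=> //; rewrite ef0 ltry.
exists (fun x => ((Num.sqrt c)%:C)%C * f0 x); first exact: inL2_scale.
by rewrite energy_scale// ef0 mule1 sqr_sqrtr.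
Qed.

Lemma exists_L2_norm (r : R) : 0 <= r -> exists f, `|f| = r.
Proof.
move=> r0; have [f hf Ef] := exists_energy (sqr_ge0 r); exists (L2_class f).
have := L2_normE (L2_class f); rewrite energy_class// Ef => -[].
by move/eqP; rewrite eqrXn2// => /eqP.
Qed.

Lemma L2_class_subE (F : 'cV[R]_d -> R[i]) g : inL2 F ->
  (`|L2_class F - g| ^+ 2)%:E = energy (F - (g : 'cV[R]_d -> R[i])).
Proof.
move=> hF; rewrite L2_normE energyB_ae.
apply: energy_ae.
- by apply: cmeasurableB; exact: (L2_inL2 _).1.
- by apply: cmeasurableB; [exact: hF.1|exact: (L2_inL2 _).1].
- by apply: filterS (L2_classE hF) => x Fx xT; rewrite !fctE Fx.
Qed.

End L2_consequences.

Section main.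
Context {R : realType} {d : nat}.
Variables (chi : L2 R d) (Psi : set (L2 R d)) (A : nat -> 'M[R]_d).
Hypotheses (tight : tight_frame chi Psi)
  (uA : forall m, A m \in unitmx) (detA : `|\det (A m)| @[m --> \oo] --> +oo)
  (Psi_incl : forall m,
      dilate_set 1 (invmx (A m)) Psi `<=` dilate_set 1 (invmx (A m.+1)) Psi).
Local Notation W N := (energy_remainder N Psi).

Lemma slow_decay_L2 (g : L2 R d) (E : nat -> R) : positive_nonincreasing_null E ->
  exists f : L2 R d, `|f - g| ^+ 2 <= 9 / 4 * E 1%N * `|g| ^+ 2 /\
    forall N, (0 < N)%N -> ((`|g| ^+ 2 / 8 * E N)%:E <= W N f)%E.
Proof.
move=> HE.
have [F [hF FB FW]] := slow_decay (L2_inL2 chi) tight uA detA Psi_incl (L2_inL2 g) HE.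
exists (L2_class F); split.
  by rewrite -lee_fin L2_class_subE// EFinM L2_normE.
move=> N N0; rewrite energy_remainder_class//; apply: le_trans (FW N N0).
rewrite -L2_normE -EFinM lee_fin.
by rewrite (_ : `|g| ^+ 2 / 8 * E N = E N / 8 * `|g| ^+ 2)//; ring.
Qed.

Lemma hump_L2 (f : L2 R d) (N : nat) (r : R) : 0 < r ->
  exists f' : L2 R d, `|f' - f| = r /\ ((3 / 4 * r ^+ 2)%:E <= W N f')%E.
Proof.
move=> r0; have r20 : 0 < r ^+ 2 by rewrite exprn_gt0.
have [h hh Eh] := @exists_energy R d (r ^+ 2) (ltW r20).
have e0 : 0 < r ^+ 2 / 4 by rewrite divr_gt0.
have [v [hv Ev Hv]] := hump (L2_inL2 chi) tight uA detA Psi_incl N (L2_inL2 f) hh e0.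
have hfv := inL2D (L2_inL2 f) hv.
exists (L2_class ((f : 'cV[R]_d -> R[i]) + v)); split.
  have := L2_class_subE f hfv; rewrite addrAC subrr add0r Ev Eh => -[] /eqP.
  by rewrite eqrXn2// ?ltW// => /eqP.
rewrite energy_remainder_class//; move: Hv; rewrite Eh -leeBlDr// -EFinB.
by apply: le_trans; rewrite lee_fin; lra.
Qed.

Lemma remainder_lipschitz N (f g : L2 R d) :
  (W N f <= 2%:E * W N g + 2%:E * (`|f - g| ^+ 2)%:E)%E.
Proof.
have := remainder_weighted tight N ltr01 (L2_inL2 f) (L2_inL2 g).
by rewrite invr1 L2_normE energyB_ae.
Qed.

(** One index serves for both constants in the O: enlarging it weakens the two
    conditions simultaneously. *)
Definition uniform_decay (E : nat -> R) n : set (L2 R d) :=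
  [set f : L2 R d | forall N, (n < N)%N -> (W N f <= (n.+1%:R * E N)%:E)%E].

Lemma remainder_bigO_bigcup (E : nat -> R) : positive_nonincreasing_null E ->
  remainder_bigO Psi E = \bigcup_n uniform_decay E n.
Proof.
move=> [Epos _ _]; apply/seteqP; split=> f.
  move=> [C C0 [N0 N00 H]]; exists (maxn N0 (Num.truncn C)) => // N nN.
  have N0N : (N0 < N)%N by apply: leq_ltn_trans nN; exact: leq_maxl.
  apply: le_trans (H N (ltnW N0N)) _; rewrite lee_fin ler_pM2r; last first.
    by apply: Epos; exact: leq_ltn_trans N0N.
  apply: le_trans (ltW (truncnS_gt C)) _.
  by rewrite ler_nat ltnS leq_maxr.
move=> [n _ H]; exists n.+1%:R; first by rewrite ltr0n.
by exists n.+1 => // N; exact: H.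
Qed.

(** If a ball were contained in the closure, a hump inside this ball with W_N
    too large for some N would be a limit of functions with small W_N, contrary
    to the Lipschitz property. *)
Lemma uniform_decay_nowhere_dense (E : nat -> R) n : positive_nonincreasing_null E ->
  nowhere_dense (uniform_decay E n).
Proof.
move=> HE; rewrite /nowhere_dense; apply/seteqP; split=> // f.
rewrite /interior /= => /nbhs_ballP[e /= e0 He].
pose r := e / 2; have r0 : 0 < r by rewrite divr_gt0.
have r20 : 0 < r ^+ 2 by rewrite exprn_gt0.
have [N nN HN] := null_seq_small_after (c := n.+1%:R) n HE (ltr0Sn _ _) (divr_gt0 r20 (ltr0Sn _ 7)).
have [f' [ff' Wf']] := hump_L2 f N r0.
have f'S : closure (uniform_decay E n) f'.
  by apply: He; rewrite -ball_normE /= distrC ff' /r; lra.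
(* The contradiction is 3/4 r^2 <= 2 (r^2 / 8) + 2 (r^2 / 9). *)
pose eta := r / 3; have eta0 : 0 < eta by rewrite divr_gt0.
have [g [Sg]] := f'S (ball f' eta) (nbhsx_ballx f' eta eta0).
rewrite -ball_normE /= => f'g.
have := le_trans Wf' (remainder_lipschitz N f' g).
have := Sg N nN; have := energy_remainder_ge0 N Psi (g : L2 R d).
case: (W N (g : L2 R d)) => [b| |]//; rewrite -!EFinM -EFinD !lee_fin => b0 bE.
have : `|f' - g| ^+ 2 <= eta ^+ 2 by rewrite lerXn2r ?nnegrE ?normr_ge0 ?(ltW eta0) ?(ltW f'g).
rewrite /eta expr_div_n => fg2 H; exfalso; move: r20 HN bE fg2 H.
set q := r ^+ 2; set x := `|_| ^+ 2; set y := n.+1%:R * _; move=> *; lra.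
Qed.

(** Apply [slow_decay_L2] to a nonzero g near the given point and to the
    sequence c sqrt(E_N), which tends to 0 more slowly than E_N. *)
Lemma dense_not_bigO (E : nat -> R) : positive_nonincreasing_null E ->
  dense (~` remainder_bigO Psi E).
Proof.
move=> HE O [f0 Of0] oO; have [Epos _ _] := HE.
have /nbhs_ballP[e /= e0 He] : nbhs f0 O by exact: open_nbhs_nbhs.
have [g [g0 gf0]] : exists g : L2 R d, 0 < `|g| /\ `|f0 - g| < e / 2.
  have [->|f0n0] := eqVneq f0 0; last first.
    by exists f0; rewrite normr_gt0 f0n0 subrr normr0 divr_gt0.
  have [g Eg] := @exists_L2_norm R d (e / 4) (ltW (divr_gt0 e0 (ltr0Sn _ _))).
  by exists g; rewrite sub0r normrN Eg divr_gt0//; split => //; lra.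
have g20 : 0 < `|g| ^+ 2 by rewrite exprn_gt0.
(* Small enough for the function f obtained below to be at distance less than e
   / 2 from g. *)
pose c := (e / 2) ^+ 2 / (9 / 4 * `|g| ^+ 2 * (Num.sqrt (E 1%N) + 1)) / 2.
have s1 : 0 < Num.sqrt (E 1%N) + 1 by rewrite ltr_wpDl ?sqrtr_ge0.
have c0 : 0 < c by rewrite !divr_gt0 ?exprn_gt0 ?divr_gt0 ?mulr_gt0.
have HE' := sqrt_positive_nonincreasing_null c0 HE.
have [f [fg Wf]] := slow_decay_L2 g HE'.
exists f; split.
  apply: He; rewrite -ball_normE /= -(subrK g f0) -addrA.
  apply: le_lt_trans (ler_normD _ _) _.
  suff : `|g - f| < e / 2 by lra.
  have e20 : 0 <= e / 2 by rewrite divr_ge0// ltW.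
  rewrite distrC -(@ltr_pXn2r _ 2%N) ?nnegrE ?normr_ge0//.
  apply: le_lt_trans fg _.
  have -> : 9 / 4 * (c * Num.sqrt (E 1%N)) * `|g| ^+ 2 =
     (e / 2) ^+ 2 * (Num.sqrt (E 1%N) / (Num.sqrt (E 1%N) + 1) / 2).
    by rewrite /c; field; rewrite !gt_eqF// normr_gt0 -normr_gt0.
  rewrite gtr_pMr ?exprn_gt0 ?divr_gt0//.
  rewrite ltr_pdivrMr// mul1r ltr_pdivrMr//.
  by have := sqrtr_ge0 (E 1%N); lra.
move=> [C C0 [N0 N00 HC]].
pose q := `|g| ^+ 2 / 8 * c; have q0 : 0 < q by rewrite mulr_gt0// divr_gt0.
have [N N0N HN] := null_seq_small_after (c := 2 * C) N0 (sqrt_positive_nonincreasing_null ltr01 HE)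
  (mulr_gt0 (ltr0Sn _ 1) C0) q0.
have NN0 : (0 < N)%N by exact: leq_ltn_trans N0N.
have EN := Epos N NN0; have sN : 0 < Num.sqrt (E N) by rewrite sqrtr_gt0.
have := le_trans (Wf N NN0) (HC N (ltnW N0N)); rewrite lee_fin.
rewrite -{2}(sqr_sqrtr (ltW EN)) expr2 mulrA (mulrA C) ler_pM2r// -/q => qC.
by move: HN; rewrite mul1r; lra.
Qed.

Lemma inf_limsup_remainder :
  ereal_inf [set ereal_inf [set
            limn_esup (fun m => W k (dilate 2 (A m) f))
          | k in [set k | (0 < k)%N]]
        | f in [set f : L2 R d | `|f| = 1]] = 1%E.
Proof.
have E1 (f : L2 R d) k : `|f| = 1 -> limn_esup (fun m => W k (dilate 2 (A m) f)) = 1%E.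
  move=> f1; have := cvg_energy_remainder_dilate (L2_inL2 chi) tight uA detA Psi_incl k (L2_inL2 f).
  by move=> /cvg_limn_einf_sup[_ ->]; rewrite -L2_normE f1 expr1n.
rewrite (_ : [set _ | f in _] = [set 1%E]) ?ereal_inf1//.
apply/seteqP; split=> [_ [f f1 <-]|_ ->] /=.
  rewrite (_ : [set _ | k in _] = [set 1%E]) ?ereal_inf1//.
  apply/seteqP; split=> [_ [k _ <-]|_ ->] /=; first exact: E1.
  by exists 1%N => //; exact: E1.
have [f f1] := @exists_L2_norm R d 1 ler01; exists f => //.
rewrite (_ : [set _ | k in _] = [set 1%E]) ?ereal_inf1//.
apply/seteqP; split=> [_ [k _ <-]|_ ->] /=; first exact: E1.
by exists 1%N => //; exact: E1.
Qed.

End main.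

Lemma tight_frame_L2 (R : realType) (d : nat) (chi : L2 R d) (Psi : set (L2 R d)) :
  (forall f : L2 R d,
      (Lpnorm 2 (convolution f chi) ^+ 2 +
       \esum_(psi in Psi) Lpnorm 2 (convolution f (psi : L2 R d)) ^+ 2)%E = (`|f| ^+ 2)%:E) ->
  tight_frame chi Psi.
Proof.
move=> H f hf; have := H (L2_class f); rewrite L2_normE energy_class// => <-.
rewrite energyE convolution_class//; last exact: (L2_inL2 _).1.
congr (_ + _)%E; apply: eq_esum => psi _.
by rewrite energyE convolution_class//; exact: (L2_inL2 _).1.
Qed.

Set Strict Implicit.
Unset Implicit Arguments.

Theorem theorem2p7 (R : realType) (d : nat) (hd : (0 < d)%N)
    (chi : L2 R d) (Psi : set (L2 R d))
    (chi_L1 : (Lpnorm 1 chi < +oo)%E)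
    (Psi_L1 : forall psi : L2 R d, Psi psi -> (Lpnorm 1 psi < +oo)%E)
    (F_countable : countable ([set chi] `|` Psi))
    (F_infinite : infinite_set ([set chi] `|` Psi))
    (F_parseval : forall f : L2 R d,
      (Lpnorm 2 (convolution f chi) ^+ 2 +
       \esum_(psi in Psi) Lpnorm 2 (convolution f (psi : L2 R d)) ^+ 2)%E = (`|f| ^+ 2)%:E)
    (A : nat -> 'M[R]_d)
    (A_unit : forall m, A m \in unitmx)
    (A_sigma : sigma_min (A m) @[m --> \oo] --> +oo)
    (Psi_incl : forall m,
      dilate_set 1 (invmx (A m)) Psi `<=` dilate_set 1 (invmx (A m.+1)) Psi) :
  [/\ semidiscrete_parseval_frame
        (\bigcup_m dilate_set 1 (invmx (A m)) Psi),
      forall (f : L2 R d) (k : nat), (0 < k)%N ->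
        energy_remainder k Psi (dilate 2 (A m) f) @[m --> \oo]
          --> (`|f| ^+ 2)%:E,
      ereal_inf [set ereal_inf [set
            limn_esup (fun m => energy_remainder k Psi (dilate 2 (A m) f))
          | k in [set k | (0 < k)%N]]
        | f in [set f : L2 R d | `|f| = 1]] = 1%E,
      forall g : L2 R d, exists2 C : R, 0 < C &
        forall E : nat -> R, positive_nonincreasing_null E ->
        exists f : L2 R d,
          [/\ `|f| ^+ 2 <= C * (1 + E 1%N),
              `|f - g| ^+ 2 <= C * E 1%N
            & forall N, (0 < N)%N ->
                ((`|g| ^+ 2 / 8 * E N)%:E <= energy_remainder N Psi f)%E]
    & forall E : nat -> R, positive_nonincreasing_null E ->
        (exists2 S : nat -> set (L2 R d), (forall n, nowhere_dense (S n)) &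
          remainder_bigO Psi E = \bigcup_n S n) /\
        dense (~` remainder_bigO Psi E)].
Proof.
have tight := tight_frame_L2 F_parseval.
have detA := det_dvg hd A_sigma.
split.
- move=> f; rewrite L2_normE -(limit_frame (L2_inL2 chi) tight A_unit detA Psi_incl (L2_inL2 f)).
  by apply: eq_esum => psi _; rewrite energyE.
- move=> f k _; rewrite L2_normE.
  exact: (cvg_energy_remainder_dilate (L2_inL2 chi) tight A_unit detA Psi_incl k (L2_inL2 f)).
- exact: (inf_limsup_remainder tight A_unit detA Psi_incl).
- move=> g; exists (9 / 2 * `|g| ^+ 2 + 1).
    by rewrite ltr_wpDl// mulr_ge0// sqr_ge0.
  move=> E HE; have [Epos _ _] := HE; have E1 := Epos 1%N isT.
  have [f [fg Wf]] := slow_decay_L2 tight A_unit detA Psi_incl g HE.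
  have g20 : 0 <= `|g| ^+ 2 by exact: sqr_ge0.
  have gE : 0 <= E 1%N * `|g| ^+ 2 by rewrite mulr_ge0// ltW.
  exists f; split=> //; last by nra.
  have : `|f| ^+ 2 <= 2 * `|f - g| ^+ 2 + 2 * `|g| ^+ 2.
    have := energyD_weighted ltr01 (L2_inL2 (f - g)).1 (L2_inL2 g).1.
    by rewrite -energyD_ae subrK invr1 -!L2_normE -!EFinM -EFinD lee_fin.
  nra.
- move=> E HE; split; last exact: (dense_not_bigO tight A_unit detA Psi_incl HE).
  exists (uniform_decay Psi E); last exact: remainder_bigO_bigcup.
  by move=> n; exact: (uniform_decay_nowhere_dense tight A_unit detA Psi_incl).
Qed.
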